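(* Let $\mathcal{D}\subset\mathbb{R}^N$ be an open, bounded domain satisfying the external cone condition. Then every $x\in\partial\mathcal{D}$ is game-regular, i.e., for every $x\in\partial\mathcal{D}$: for all $\xi,\delta>0$ there exist $\hat\delta,\hat\epsilon>0$ such that for all $\epsilon\in(0,\hat\epsilon)$ and all $\bar x\in B_{\hat\delta}(x)\cap\mathcal{D}$ there exists a strategy $\sigma_{I,0}$ such that for every strategy $\sigma_{II}$: $$\mathbb{P}\big(X_\tau^{\epsilon,\bar x,\sigma_{I,0},\sigma_{II}}\notin B_\delta(x)\big)\le\xi.$$
   Context: Fix an integer $N\ge 2$, $\mathbf p\in[2,\infty)$ and $s\in(\frac12,1)$. $B_r(x)$ is the open ball, $e_1,e_2,\dots$ the standard basis of $\mathbb{R}^N$, $\angle(y,z)$ the angle between vectors. $\mathrm{d}\mu_s^N(z)=\frac{C(N,s)}{|z|^{N+2s}}\,\mathrm{d}z$ with $C(N,s)=\frac{4^s s\,\Gamma(\frac N2+s)}{\pi^{N/2}\Gamma(1-s)}$. Let $\alpha_{\mathbf p}\in(0,\frac\pi2]$ be the angle such that, with $A_{\mathbf p}=\{|z|=1:\ \angle(e_1,z)<\alpha_{\mathbf p}\}$ and $\sigma$ the surface measure on the unit sphere, $\mathbf p-1=\int_{A_{\mathbf p}}\langle z,e_1\rangle^2\,\mathrm{d}\sigma(z)\big/\int_{A_{\mathbf p}}\langle z,e_2\rangle^2\,\mathrm{d}\sigma(z)$. Let $T_{\mathbf p}^{1,\infty}=\{z\in\mathbb{R}^N:\ \angle(e_1,z)<\alpha_{\mathbf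 p},\ |z|>1\}$. External cone condition: there exists a finite cone $C$ (a truncated circular cone with vertex at $0$, positive aperture and positive height) such that for each $x\in\partial\mathcal{D}$ there is a rotation $S_x\in SO(N)$ with $x+S_xC\subset\mathbb{R}^N\setminus\mathcal{D}$. Rotations: for unit vectors $y\ne\tilde y$, $R_{\tilde y,y}\in SO(N)$ is the orientation preserving rotation in the plane spanned by $y,\tilde y$ with $R_{\tilde y,y}y=\tilde y$; $R_{y,y}=Id_N$; for $\tilde y=-y$ fix any rotation in $SO(N)$ mapping $y$ to $-y$. Game: $(\Omega_1,\mathcal{F}_1,\mathbb{P}_1)$ is the product of $T_{\mathbf p}^{1,\infty}$ with its Borel $\sigma$-algebra and the probability measure $\mu_s^N/\mu_s^N(T_{\mathbf p}^{1,\infty})$, and of $\{1,2\}$ with the uniform probability. $(\Omega,\mathcal{F},\mathbb{P})$ is the countable product of copies of $\Omega_1$, with elements $\omega=\{(z_i,s_i)\}_{i=1}^\infty$. A strategy $\sigma_I=\{\sigma_I^n\}_{n=0}^\infty$ (of player I), respectively $\sigma_{II}=\{\sigma_{II}^n\}_{n=0}^\infty$ (of player II), is a sequence of measurable functions from the space of finite histories $H_n=\mathbb{R}^N\times(\mathbb{R}^N\times\Omega_1)^n$ to the unit sphere. Given a starting point $x\in\mathbb{R}^N$, $\epsilon>0$ and strategies, the process $X_n=X_n^{\epsilon,x,\sigma_I,\sigma_{II}}$ is: $X_0\equiv x$ and, for $n\ge1$, $X_n=X_{n-1}+\epsilon R_{\sigma_I^{n-1},e_1}z_n$ if $s_n=1$,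 $X_n=X_{n-1}+\epsilon R_{\sigma_{II}^{n-1},e_1}z_n$ if $s_n=2$, where $\sigma_I^{n-1},\sigma_{II}^{n-1}$ are evaluated at the history $(X_0,(X_1,z_1,s_1),\dots,(X_{n-1},z_{n-1},s_{n-1}))$. The stopping time is $\tau=\min\{n\ge1:\ X_n\notin\mathcal{D}\}$, finite $\mathbb{P}$-a.s. *)

(* Defs.v *)
From HB Require Import structures.
From mathcomp Require Import all_boot all_order all_algebra.
From mathcomp Require Import all_classical all_reals all_analysis.
From mathcomp Require Import measurable_realfun ring.

Set Implicit Arguments.
Unset Strict Implicit.
Unset Printing Implicit Defensive.

Import Order.TTheory GRing.Theory Num.Theory.
Import numFieldNormedType.Exports.

Local Open Scope classical_set_scope.
Local Open Scope ring_scope.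

(* Points of R^N are row vectors; the norm that the library puts on them is the
   sup norm, so the Euclidean one is defined here (the topology is the same). *)
Section euclidean.
Context {R : realType} {N : nat}.
Implicit Types (u v x y z : 'rV[R]_N) (r : R).

Definition dotv u v : R := \sum_i u 0 i * v 0 i.

Definition enorm v : R := Num.sqrt (dotv v v).

Definition eball x r : set 'rV[R]_N := [set y | enorm (y - x) < r].

Definition angle y z : R := acos (dotv y z / (enorm y * enorm z)).

Definition unit_sphere : set 'rV[R]_N := [set z | enorm z = 1].

(* Matrices act on row vectors from the right: the image of v under M is
   v *m M. *)
Definition rotation (M : 'M[R]_N) : Prop := M *m M^T = 1%:M /\ \det M = 1.

End euclidean.

(* Indices start at 0: e_1 and e_2 of the usual numbering are ebase N 0 and
   ebase N 1. *)
Definition ebase {R : realType} (N k : nat) : 'rV[R]_N :=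
  \row_j (nat_of_ord j == k)%:R.

HB.instance Definition _ (R : realType) (n : nat) :=
  @isMeasurable.Build (sigma_display (@open 'rV[R]_n)) 'rV[R]_n
    <<s @open 'rV[R]_n >> (@sigma_algebra0 _ setT _) (@sigma_algebraC _ _)
    (@sigma_algebra_bigcup _ setT _).

Section borel_rV.
Context {R : realType}.

Lemma open_measurable_rV n (U : set 'rV[R]_n) : open U -> measurable U.
Proof. by move=> oU; exact: sub_sigma_algebra. Qed.

Lemma continuous_measurable_rV n (f : 'rV[R]_n -> R) :
  continuous f -> measurable_fun setT f.
Proof.
move=> cf; apply: (measurability _ (RGenOpens.measurableE R)).
move=> _ [_ [a [b ->]] <-]; rewrite setTI.
apply: open_measurable_rV; move/continuousP : cf; apply.
exact: interval_open.
Qed.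

Lemma measurable_coord n (i : 'I_n) :
  measurable_fun setT (fun v : 'rV[R]_n => v 0 i).
Proof. by apply: continuous_measurable_rV; exact: coord_continuous. Qed.

Lemma open_rV_bigcup n (U : set 'rV[R]_n) : open U ->
  U = \bigcup_(qk : 'rV[rat]_n * nat)
        (if pselect (ball (map_mx ratr qk.1 : 'rV[R]_n) qk.2.+1%:R^-1 `<=` U)
         then ball (map_mx ratr qk.1 : 'rV[R]_n) qk.2.+1%:R^-1 else set0).
Proof.
move=> oU; apply/seteqP; split => [v Uv|v [[q k] _]]; last first.
  by case: pselect => //= qkU; exact: qkU.
have /nbhs_ballP[e /= e0 veU] : nbhs v U by exact: open_nbhs_nbhs.
have [k ke] : exists k, k.+1%:R^-1 < e / 2 :> R.
  have e20 : 0 < e / 2 by rewrite divr_gt0.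
  exists (Num.truncn (e / 2)^-1); rewrite invf_plt ?posrE//.
  exact: truncnS_gt.
have k0 : 0 < k.+1%:R^-1 :> R by rewrite invr_gt0.
have [q qv] : exists q : 'rV[rat]_n,
    ball (map_mx ratr q : 'rV[R]_n) k.+1%:R^-1 v.
  have H i : exists q : rat, ball (ratr q : R) k.+1%:R^-1 (v 0 i).
    have /rat_in_itvoo[q] : v 0 i - k.+1%:R^-1 < v 0 i + k.+1%:R^-1.
      by rewrite ltrBlDr -addrA ltrDl addr_gt0.
    rewrite in_itv/= => /andP[q1 q2]; exists q.
    by rewrite -ball_normE/= ltr_distl q1 q2.
  have [f fP] := choice H.
  by exists (\row_i f i); split=> // i j; rewrite !mxE ord1.
exists (q, k) => //=; case: pselect => //= -[] w qw; apply: veU.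
apply: (@le_ball _ _ _ (k.+1%:R^-1 + k.+1%:R^-1)); first by rewrite [leRHS]splitr lerD// ltW.
by apply: ball_triangle qw; exact: ball_sym.
Qed.

Lemma measurable_fun_rVP d (T : measurableType d) n (f : T -> 'rV[R]_n) :
  (forall i, measurable_fun setT (fun t => f t 0 i)) -> measurable_fun setT f.
Proof.
move=> mf; apply: (@measurability _ _ _ _ _ _ (@open 'rV[R]_n)) => //.
move=> _ [U oU <-]; rewrite setTI (open_rV_bigcup oU) preimage_bigcup.
apply: countable_bigcupT_measurable; first exact: countableP.
move=> [q k]; case: pselect => qk /=; last by rewrite preimage_set0.
have -> : f @^-1` ball (map_mx ratr q : 'rV[R]_n) k.+1%:R^-1 =
    \bigcap_(i in [set: 'I_n])
      ((fun t => f t 0 i) @^-1` ball (ratr (q 0 i) : R) k.+1%:R^-1).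
  apply/seteqP; split => [t [_ H] i _ /=|t H].
    by have := H 0 i; rewrite mxE.
  by split => // i j; rewrite mxE ord1; exact: H.
apply: fin_bigcap_measurable => // i _; rewrite -[X in measurable X]setTI.
by apply: mf => //; apply: open_measurable; exact: ball_open.
Qed.

Definition consrV n (p : R * 'rV[R]_n) : 'rV[R]_n.+1 :=
  \row_i (if unlift ord0 i is Some j then p.2 0 j else p.1).

Definition unconsrV n (v : 'rV[R]_n.+1) : R * 'rV[R]_n :=
  (v 0 ord0, \row_j v 0 (lift ord0 j)).

Lemma consrVK n : cancel (@consrV n) (@unconsrV n).
Proof.
move=> [x v]; rewrite /unconsrV/consrV; congr pair.
  by rewrite mxE unlift_none.
by apply/rowP => j; rewrite !mxE liftK.
Qed.

Lemma measurable_consrV n : measurable_fun setT (@consrV n).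
Proof.
apply: measurable_fun_rVP => i; rewrite /consrV.
have [j|] := unliftP ord0 i => ?; subst i.
  under eq_fun do rewrite mxE liftK.
  exact: (measurableT_comp (@measurable_coord n j) measurable_snd).
under eq_fun do rewrite mxE unlift_none.
exact: measurable_fst.
Qed.

Lemma measurable_unconsrV n : measurable_fun setT (@unconsrV n).
Proof.
apply/measurable_fun_pairP; split; first exact: measurable_coord.
apply: measurable_fun_rVP => i; under eq_fun do rewrite mxE.
exact: measurable_coord.
Qed.

Lemma measurable_invr : measurable_fun setT (@GRing.inv R).
Proof.
rewrite -(setvU [set 0 : R]); apply/measurable_funU => //.
  exact: measurableC.
split; last exact: measurable_fun_set1.
apply: open_continuous_measurable_fun.
  by apply: closed_openC; exact: closed_eq.
by move=> x; rewrite inE/= => /eqP x0; exact: inv_continuous.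
Qed.

End borel_rV.

Section lebesgue_consrV.
Context {R : realType} {n : nat}.
Variable m : {sigma_finite_measure set 'rV[R]_n -> \bar R}.

Definition lebesgue_consrV : set 'rV[R]_n.+1 -> \bar R :=
  pushforward (@lebesgue_measure R \x m)%E (@consrV R n).

Let mf := @measurable_consrV R n.

Let m0 : lebesgue_consrV set0 = 0%E.
Proof. exact: measure0. Qed.

Let m_ge0 A : (0 <= lebesgue_consrV A)%E.
Proof. exact: measure_ge0. Qed.

Let m_sigma_additive : semi_sigma_additive lebesgue_consrV.
Proof. exact: measure_semi_sigma_additive. Qed.

HB.instance Definition _ := isMeasure.Build _ _ _ lebesgue_consrV
  m0 m_ge0 m_sigma_additive.

Let m_sigma_finite : sigma_finite setT lebesgue_consrV.
Proof.
have /sigma_finiteP[F [FT ndF Foo]] := sigma_finiteT (@lebesgue_measure R).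
have /sigma_finiteP[G [GT ndG Goo]] := sigma_finiteT m.
exists (fun k => @unconsrV R n @^-1` (F k `*` G k)).
  rewrite -preimage_bigcup (_ : \bigcup_k _ = setT) ?preimage_setT//.
  apply/seteqP; split=> // -[x v] _.
  have : setT x by []. rewrite FT => -[i _ Fx].
  have : setT v by []. rewrite GT => -[j _ Gv].
  exists (maxn i j) => //; split => /=.
    by move: x Fx; exact/subsetPset/ndF/leq_maxl.
  by move: v Gv; exact/subsetPset/ndG/leq_maxr.
move=> k; have [mF Fk] := Foo k; have [mG Gk] := Goo k; split.
  by rewrite -[X in measurable X]setTI; apply: measurable_unconsrV => //;
    exact: measurableX.
rewrite /lebesgue_consrV /pushforward -comp_preimage.
rewrite (_ : _ \o _ = id) ?preimage_id; last first.
  by apply/funext => p; exact: consrVK.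
by rewrite product_measure1E// lte_mul_pinfty// ge0_fin_numE.
Qed.

HB.instance Definition _ := Measure_isSigmaFinite.Build _ _ _ lebesgue_consrV
  m_sigma_finite.

End lebesgue_consrV.

(* R^0 is a single point and R^(n+1) is R x R^n. *)
Fixpoint lebesgue_rV {R : realType} (n : nat) :
    {sigma_finite_measure set 'rV[R]_n -> \bar R} :=
  match n with
  | 0 => \d_(0 : 'rV[R]_0)
  | k.+1 => lebesgue_consrV (lebesgue_rV k)
  end.

Section euclidean_measurable.
Context {R : realType} {N : nat}.
Implicit Types u v : 'rV[R]_N.

Lemma measurable_dotv d (T : measurableType d) (f g : T -> 'rV[R]_N) :
  measurable_fun setT f -> measurable_fun setT g ->
  measurable_fun setT (fun t => dotv (f t) (g t)).
Proof.
move=> mf mg; apply: measurable_sum => i.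
by apply: measurable_funM;
  apply: (measurableT_comp (@measurable_coord R N i)).
Qed.

Lemma measurable_enorm : measurable_fun setT (@enorm R N).
Proof.
apply: measurableT_comp.
  by apply: continuous_measurable_fun; exact: sqrt_continuous.
exact: measurable_dotv.
Qed.

Lemma enorm_ge0 v : 0 <= enorm v. Proof. exact: sqrtr_ge0. Qed.

Lemma dotvv_ge0 v : 0 <= dotv v v.
Proof. by apply: sumr_ge0 => i _; rewrite -expr2 sqr_ge0. Qed.

Lemma dotvv_eq0 v : (dotv v v == 0) = (v == 0).
Proof.
apply/eqP/eqP => [|->]; last first.
  by rewrite /dotv big1// => i _; rewrite mxE mul0r.
move=> v0; apply/rowP => i; rewrite mxE; apply/eqP.
rewrite -sqrf_eq0 expr2; apply/eqP.
by apply: (psumr_eq0P _ v0) => // j _; rewrite -expr2 sqr_ge0.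
Qed.

Lemma enorm_eq0 v : (enorm v == 0) = (v == 0).
Proof.
by rewrite -dotvv_eq0 /enorm sqrtr_eq0 le_eqVlt ltNge dotvv_ge0 orbF.
Qed.

Lemma dotvC u v : dotv u v = dotv v u.
Proof. by apply: eq_bigr => i _; rewrite mulrC. Qed.

Lemma dotv_sqrB (b c : R) u v : dotv (b *: u - c *: v) (b *: u - c *: v) =
  b ^+ 2 * dotv u u - 2 * b * c * dotv u v + c ^+ 2 * dotv v v.
Proof.
rewrite /dotv !mulr_sumr -sumrB -big_split/=; apply: eq_bigr => i _.
by rewrite !mxE; ring.
Qed.

Lemma cauchy_schwarz u v : `|dotv u v| <= enorm u * enorm v.
Proof.
rewrite -sqrtrM ?dotvv_ge0// -sqrtr_sqr ler_sqrt ?mulr_ge0 ?dotvv_ge0//.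
have [->|v0] := eqVneq v 0.
  by rewrite {1}/dotv big1 ?expr0n ?mulr_ge0 ?dotvv_ge0// => i _;
    rewrite mxE mulr0.
have B0 : 0 < dotv v v by rewrite lt_neqAle eq_sym dotvv_eq0 v0 dotvv_ge0.
pose C := dotv u v; pose A := dotv u u; pose B := dotv v v.
have : 0 <= dotv (B *: u - C *: v) (B *: u - C *: v) by exact: dotvv_ge0.
have -> : dotv (B *: u - C *: v) (B *: u - C *: v) = B * (A * B - C ^+ 2).
  rewrite dotv_sqrB -/A -/B -/C; ring.
by rewrite pmulr_rge0// subr_ge0.
Qed.

Lemma angle_cos_bound u v : -1 <= dotv u v / (enorm u * enorm v) <= 1.
Proof.
have [n0|n0] := eqVneq (enorm u * enorm v) 0.
  by rewrite n0 invr0 mulr0 lerN10 ler01.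
have n1 : 0 < enorm u * enorm v by rewrite lt_neqAle eq_sym n0 mulr_ge0 ?enorm_ge0.
by rewrite -ler_norml normrM normfV (gtr0_norm n1) ler_pdivrMr// mul1r cauchy_schwarz.
Qed.

Lemma measurable_angle_lt u (a : R) : measurable [set z | angle u z < a].
Proof.
have mc : measurable_fun setT (fun z => dotv u z / (enorm u * enorm z)).
  apply: measurable_funM; first exact: measurable_dotv.
  apply: (measurableT_comp measurable_invr).
  by apply: measurable_funM => //; exact: measurable_enorm.
have [a0|a0] := leP a 0.
  rewrite (_ : [set z | _] = set0)//; apply/seteqP; split=> z //=.
  by rewrite ltNge (le_trans a0)// acos_ge0// angle_cos_bound.
have [api|api] := ltP pi a.
  rewrite (_ : [set z | _] = setT)//; apply/seteqP; split=> z //= _.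
  by rewrite (le_lt_trans _ api)// acos_lepi// angle_cos_bound.
have ain : a \in `[0, pi] by rewrite in_itv/= (ltW a0).
rewrite (_ : [set z | _] =
  (fun z => dotv u z / (enorm u * enorm z)) @^-1` `]cos a, +oo[); last first.
  apply/seteqP; split=> z /=; rewrite in_itv/= andbT /angle;
    have /acos_def[acos0 acosE] := angle_cos_bound u z.
    by move=> za; rewrite -[ltRHS]acosE ltr_cos// in_itv.
  by rewrite -[ltRHS]acosE ltr_cos// in_itv.
by rewrite -[X in measurable X]setTI; exact: mc.
Qed.

End euclidean_measurable.

Section sphere.
Context {R : realType} {N : nat}.
Implicit Types (z : 'rV[R]_N) (A : set 'rV[R]_N) (a p : R).

Definition sphere_proj z : 'rV[R]_N := (enorm z)^-1 *: z.

Lemma measurable_sphere_proj : measurable_fun setT sphere_proj.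
Proof.
apply: measurable_fun_rVP => i; under eq_fun do rewrite mxE.
apply: measurable_funM; last exact: measurable_coord.
exact: (measurableT_comp measurable_invr measurable_enorm).
Qed.

Definition pointed_ball : set 'rV[R]_N := [set z | 0 < enorm z <= 1].

Lemma measurable_pointed_ball : measurable pointed_ball.
Proof.
rewrite (_ : pointed_ball = @enorm R N @^-1` `]0, 1]); last first.
  by apply/seteqP; split => z /=; rewrite in_itv.
by rewrite -[X in measurable X]setTI; exact: measurable_enorm.
Qed.

(* The volume of the cone {t z | z in A, 0 < t <= 1} over the part of A that lies
   on the unit sphere *)
Definition cone_volume : set 'rV[R]_N -> \bar R :=
  pushforward (mrestr (lebesgue_rV N) measurable_pointed_ball) sphere_proj.

Let mf := measurable_sphere_proj.

Let cone_volume0 : cone_volume set0 = 0%E.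
Proof. exact: measure0. Qed.

Let cone_volume_ge0 A : (0 <= cone_volume A)%E.
Proof. exact: measure_ge0. Qed.

Let cone_volume_sigma_additive : semi_sigma_additive cone_volume.
Proof. exact: measure_semi_sigma_additive. Qed.

HB.instance Definition _ := isMeasure.Build _ _ _ cone_volume
  cone_volume0 cone_volume_ge0 cone_volume_sigma_additive.

(* Surface measure on the unit sphere, extended by 0 to R^N: by integration in
   polar coordinates it is N times the volume of the cone. *)
Definition surface_measure : {measure set 'rV[R]_N -> \bar R} :=
  mscale (N%:R%:nng : {nonneg R}) cone_volume.

Definition spherical_cap a : set 'rV[R]_N :=
  [set z | enorm z = 1 /\ angle (ebase N 0) z < a].

Definition is_alpha p a : Prop :=
  0 < a <= pi / 2 /\
  p - 1 = (\int[surface_measure]_(z in spherical_cap a)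
             dotv z (ebase N 0) ^+ 2) /
          (\int[surface_measure]_(z in spherical_cap a)
             dotv z (ebase N 1) ^+ 2).

End sphere.
Arguments spherical_cap {R} N a.
Arguments is_alpha {R} N p a.

Section gamma.
Context {R : realType}.

Definition Gamma (x : R) : R :=
  \int[lebesgue_measure]_(t in `]0, +oo[) (t `^ (x - 1) * expR (- t)).

Lemma Gamma_ge0 x : 0 <= Gamma x.
Proof.
by apply: Rintegral_ge0 => t _; rewrite mulr_ge0 ?powR_ge0 ?expR_ge0.
Qed.

Definition fracC (N : nat) (s : R) : R :=
  4 `^ s * s * Gamma (N%:R / 2 + s) / (pi `^ (N%:R / 2) * Gamma (1 - s)).

Lemma fracC_ge0 N s : 2^-1 < s < 1 -> 0 <= fracC N s.
Proof.
move=> /andP[s2 _]; have s0 : 0 <= s by rewrite (le_trans _ (ltW s2)).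
by rewrite divr_ge0 ?mulr_ge0 ?powR_ge0 ?Gamma_ge0.
Qed.

End gamma.

Section fractional_measure.
Context {R : realType} (N : nat) (s : R).

Definition riesz_density (z : 'rV[R]_N) : R := (enorm z `^ (N%:R + 2 * s))^-1.

Lemma riesz_density_ge0 z : 0 <= riesz_density z.
Proof. by rewrite invr_ge0 powR_ge0. Qed.

Lemma measurable_riesz_density : measurable_fun setT riesz_density.
Proof.
apply: (measurableT_comp measurable_invr).
exact: (measurableT_comp (measurable_powR _) measurable_enorm).
Qed.

Definition riesz_measure (A : set 'rV[R]_N) : \bar R :=
  (\int[lebesgue_rV N]_(z in A) (riesz_density z)%:E)%E.

Let riesz0 : riesz_measure set0 = 0%E.
Proof. exact: integral_set0. Qed.

Let riesz_ge0 A : (0 <= riesz_measure A)%E.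
Proof. by apply: integral_ge0 => z _; rewrite lee_fin riesz_density_ge0. Qed.

Let riesz_sigma_additive : semi_sigma_additive riesz_measure.
Proof.
move=> F mF tF mUF; rewrite /riesz_measure; apply: cvg_toP.
  apply: ereal_nondecreasing_is_cvgn => m n mn.
  by apply: lee_sum_nneg_natr => // k _ _; exact: riesz_ge0.
rewrite ge0_integral_bigcup//=.
- by apply/measurable_funTS/measurable_EFinP; exact: measurable_riesz_density.
- by move=> z _; rewrite lee_fin riesz_density_ge0.
Qed.

HB.instance Definition _ := isMeasure.Build _ _ _ riesz_measure
  riesz0 riesz_ge0 riesz_sigma_additive.

Hypothesis hs : 2^-1 < s < 1.

Definition frac_measure : {measure set 'rV[R]_N -> \bar R} :=
  mscale (NngNum (fracC_ge0 N hs)) riesz_measure.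

End fractional_measure.

(* A turn is a pair (z, b) of a step z and a coin b, which is true when player I
   chooses the direction. Steps range over all of R^N, but their law is carried by the
   truncated sector. *)
Notation turn R N := ('rV[R]_N * bool)%type.

Section turns.
Context {R : realType} (N : nat).

Definition truncated_sector (a : R) : set 'rV[R]_N :=
  [set z | angle (ebase N 0) z < a] `&` [set z | 1 < enorm z].

Lemma measurable_truncated_sector a : measurable (truncated_sector a).
Proof.
apply: measurableI; first exact: measurable_angle_lt.
rewrite (_ : [set z | _] = @enorm R N @^-1` `]1, +oo[); last first.
  by apply/seteqP; split => z /=; rewrite in_itv/= andbT.
by rewrite -[X in measurable X]setTI; exact: measurable_enorm.
Qed.

Variables (s a : R) (hs : 2^-1 < s < 1).

(* The normalized restriction of frac_measure to the truncated sector. The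
   sector has positive finite measure, so that the default value \d_0 of
   mnormalize is not used. *)
Definition step_law : probability 'rV[R]_N R :=
  mnormalize (mrestr (frac_measure N hs) (measurable_truncated_sector a))
    \d_(0 : 'rV[R]_N).

Definition turn_law : probability (turn R N) R := (step_law \x bernoulli_prob 2^-1)%E.

End turns.

Definition cylinders d (T : measurableType d) : set (set (nat -> T)) :=
  [set A | exists n (B : set T), measurable B /\ A = [set w | B (w n)]].

Notation seq_space T := (g_sigma_algebraType (@cylinders _ T)).

(* Q is the countable product of copies of P: the values on the cylinders
   determine it. *)
Definition is_product_law d (T : measurableType d) (R : realType)
    (P : probability T R) (Q : probability (seq_space T) R) : Prop :=
  forall (n : nat) (B : nat -> set T), (forall i, measurable (B i)) ->
    Q [set w : nat -> T | forall i, (i < n)%N -> B i (w i)] =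
    (\prod_(i < n) P (B i))%E.

Section rotations.
Context {R : realType} {N : nat}.

(* rot y' y is the rotation in the plane of y and y' that maps y to y'; any
   rotation with this property is allowed when y' = - y. Outside of that case the
   conditions determine rot y' y. *)
Definition is_rotation_family (rot : 'rV[R]_N -> 'rV[R]_N -> 'M[R]_N) : Prop :=
  forall y' y, unit_sphere y' -> unit_sphere y ->
  [/\ rotation (rot y' y),
      y *m rot y' y = y',
      y' = y -> rot y' y = 1%:M &
      y' != - y -> forall v, dotv v y = 0 -> dotv v y' = 0 ->
        v *m rot y' y = v].

End rotations.

(* (x_0, ((x_1, (z_1, b_1)), ..., (x_n, (z_n, b_n)))) *)
Notation history R N n := ('rV[R]_N * n.-tuple ('rV[R]_N * turn R N))%type.

Record strategy (R : realType) (N : nat) := Strategy {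
  direction :> forall n, history R N n -> 'rV[R]_N ;
  measurable_direction : forall n, measurable_fun setT (@direction n) ;
  direction_unit : forall n (h : history R N n), unit_sphere (direction h) }.

Section game.
Context {R : realType} {N : nat}.
Variable rot : 'rV[R]_N -> 'rV[R]_N -> 'M[R]_N.
Implicit Types (D : set 'rV[R]_N) (x : 'rV[R]_N) (eps : R).
Implicit Types (sI sII : strategy R N).
Implicit Types (w : nat -> turn R N).

Definition position n (h : history R N n) : 'rV[R]_N :=
  last h.1 [seq k.1 | k <- h.2].

(* w n is the turn (z_(n+1), s_(n+1)): coordinates are numbered from 0. *)
Fixpoint play eps x sI sII w (n : nat) : history R N n :=
  match n with
  | 0 => (x, [tuple])
  | m.+1 =>
      let h := play eps x sI sII w m in
      let: (z, b) := w m in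
      let u := if b then sI m h else sII m h in
      (h.1, [tuple of rcons h.2
               (position h + eps *: (z *m rot u (ebase N 0)), (z, b))])
  end.

Definition process eps x sI sII w n : 'rV[R]_N := position (play eps x sI sII w n).

(* The exit time of w is n *)
Definition exits_at D eps x sI sII w (n : nat) : Prop :=
  [/\ (1 <= n)%N, ~ D (process eps x sI sII w n) &
      forall k, (1 <= k < n)%N -> D (process eps x sI sII w k)].

(* The event that the exit position is not in B. The exit time is finite almost
   surely; sequences of turns that never exit are not in the event. *)
Definition exit_outside D eps x sI sII (B : set 'rV[R]_N) : set (nat -> turn R N) :=
  [set w | exists2 n, exits_at D eps x sI sII w n &
                      ~ B (process eps x sI sII w n)].

Definition game_regular (P : probability (seq_space (turn R N)) R) D x : Prop :=
  forall xi delta : R, 0 < xi -> 0 < delta ->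
  exists hdelta heps : R, [/\ 0 < hdelta, 0 < heps &
    forall eps, 0 < eps < heps ->
    forall x', eball x hdelta x' -> D x' ->
    exists sI, forall sII,
      (P (exit_outside D eps x' sI sII (eball x delta)) <= xi%:E)%E].

End game.

Section domain.
Context {R : realType} {N : nat}.
Implicit Types (D : set 'rV[R]_N).

Definition boundary D : set 'rV[R]_N := closure D `\` interior D.

(* The cone with vertex 0, axis a (a unit vector), half-aperture t and height h *)
Definition finite_cone (a : 'rV[R]_N) (t h : R) : set 'rV[R]_N :=
  [set z | z = 0 \/ (angle a z <= t /\ dotv a z <= h)].

Definition external_cone_condition D : Prop :=
  exists (a : 'rV[R]_N) (t h : R),
    [/\ unit_sphere a, 0 < t < pi / 2, 0 < h &
        forall x, boundary D x ->
        exists2 S : 'M[R]_N, rotation S &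
          [set x + z *m S | z in finite_cone a t h] `<=` ~` D].

End domain.

(* Main.v *)
Require Import Defs.
From HB Require Import structures.
From mathcomp Require Import all_boot all_order all_algebra.
From mathcomp Require Import all_classical all_reals all_analysis.
From mathcomp Require Import measurable_realfun ring lra.

Set Implicit Arguments.
Unset Strict Implicit.
Unset Printing Implicit Defensive.

Import Order.TTheory GRing.Theory Num.Theory.
Import numFieldNormedType.Exports.

Local Open Scope classical_set_scope.
Local Open Scope ring_scope.

(** The proof builds one barrier, a nonnegative function Phi for which player I has a
    strategy making Phi (X_n) a supermartingale, whatever player II does, as long as the
    walk stays in D and close to x.
    Let the exterior cone at the boundary point x have axis ax, and let v be a point of this
    axis at distance K * eps from x, inside the cone. With y = q - v the barrier is

      Phi q = (|y| - <ax, y> / 2) ^ b,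

    replaced by 0 if q is outside D and close to x. The base of the power (gauge) is
    comparable to |y|, and its gradient has length between 1/2 and 3/2. Player I pulls along
    the opposite of the gradient, which is ax / 2 - y / |y|: a jump of the right length in
    this direction leads from y to the point (|y| / 2) ax of the axis, that is, out of D.

    Write S = |y| / eps >= 8 for the distance to v in units of the jumps.
    - First-order terms. The mean step is a nonnegative multiple of e_1, because the law of
      the step is invariant under change of sign of the other coordinates
      (step_law_mean_le). Thus the mean drift of the gauge under player II is at most the
      opposite of the one under player I, and each player moves with probability 1/2.
    - Remainder. The norm satisfies |y + h| <= |y| + <y / |y|, h> + min (2 |h|, |h|^2 / (2 |y|)).
      As 1 < 2 s < 2, the mean of the last term is at most of order |y| S^(- 2 s)
      (jump_cost_integral). By concavity of the power, Phi gains at most of order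
      b |y|^b S^(- 2 s).
    - Jump out of D. When player I moves, the step is near the prescribed point of the axis
      with probability at least of order S^(- 2 s) (step_law_near), and then Phi drops from
      order |y|^b to 0.
    The last two contributions have the same order in y and eps, so a small exponent b
    depending only on the law and the aperture makes Phi a supermartingale at all scales
    (one_step_supermartingale). It is here that v is moved away from x: points of D stay at
    distance at least 8 * eps from v (far_from_vertex), so that the jump to the axis is
    longer than the minimal jump eps.

    Outside of the ball of radius d around x the barrier is at least (d / 4)^b. Hence the
    walk started at x' gets out of this ball before it exits, or on exiting, with
    probability at most Phi (x') / (d / 4)^b (escape_probability), which is at most xi if x'
    and v are close enough to x.

    The process is measurable because a rotation family is given by a rational formula
    (rotation_familyE), and expectations of the next position given the past are computed
    by Fubini, the law of the turns being a product (integral_next). *)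

(** * Euclidean geometry and rotations *)

Section dot_product.
Context {R : realType} {N : nat}.
Implicit Types (u v w : 'rV[R]_N) (c : R).

Lemma dotvDl u v w : dotv (u + v) w = dotv u w + dotv v w.
Proof. by rewrite /dotv -big_split/=; apply: eq_bigr => i _; rewrite mxE mulrDl. Qed.

Lemma dotvZl c u v : dotv (c *: u) v = c * dotv u v.
Proof. by rewrite /dotv mulr_sumr; apply: eq_bigr => i _; rewrite mxE mulrA. Qed.

Lemma dotvDr u v w : dotv w (u + v) = dotv w u + dotv w v.
Proof. by rewrite dotvC dotvDl !(dotvC w). Qed.

Lemma dotvZr c u v : dotv u (c *: v) = c * dotv u v.
Proof. by rewrite dotvC dotvZl dotvC. Qed.

Lemma dotvNl u v : dotv (- u) v = - dotv u v.
Proof. by rewrite -scaleN1r dotvZl mulN1r. Qed.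

Lemma dotvNr u v : dotv u (- v) = - dotv u v.
Proof. by rewrite dotvC dotvNl dotvC. Qed.

Definition dotvE := (dotvDl, dotvDr, dotvNl, dotvNr, dotvZl, dotvZr).

Lemma dotv_mx u v : dotv u v = (u *m v^T) 0 0.
Proof. by rewrite mxE; apply: eq_bigr => i _; rewrite mxE. Qed.

Lemma enorm_sqr u : enorm u ^+ 2 = dotv u u.
Proof. by rewrite sqr_sqrtr// dotvv_ge0. Qed.

Lemma enorm1_dotv u : enorm u = 1 -> dotv u u = 1.
Proof. by move=> u1; rewrite -enorm_sqr u1 expr1n. Qed.

Lemma enormZ c u : enorm (c *: u) = `|c| * enorm u.
Proof.
by rewrite /enorm dotvZl dotvZr mulrA -expr2 sqrtrM ?sqr_ge0// sqrtr_sqr.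
Qed.

Lemma enormN u : enorm (- u) = enorm u.
Proof. by rewrite -scaleN1r enormZ normrN1 mul1r. Qed.

Lemma ler_enormD u v : enorm (u + v) <= enorm u + enorm v.
Proof.
rewrite -(ler_pXn2r (n := 2)) ?nnegrE ?addr_ge0 ?enorm_ge0//.
rewrite sqrrD !enorm_sqr !dotvE (dotvC v u).
have := le_trans (ler_norm _) (cauchy_schwarz u v); lra.
Qed.

Lemma dotv_le u v : dotv u v <= enorm u * enorm v.
Proof. exact: le_trans (ler_norm _) (cauchy_schwarz u v). Qed.

Lemma enorm_normalize u : u != 0 -> enorm ((enorm u)^-1 *: u) = 1.
Proof.
by move=> u0; rewrite enormZ ger0_norm ?invr_ge0 ?enorm_ge0// mulVf// enorm_eq0.
Qed.

Lemma dotv_rotation (M : 'M[R]_N) u v : rotation M ->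
  dotv (u *m M) (v *m M) = dotv u v.
Proof. by move=> [MM _]; rewrite !dotv_mx trmx_mul mulmxA -(mulmxA u) MM mulmx1. Qed.

Lemma enorm_rotation (M : 'M[R]_N) u : rotation M -> enorm (u *m M) = enorm u.
Proof. by move=> rM; rewrite /enorm dotv_rotation. Qed.

End dot_product.

(** The block matrix with diagonal blocks 1 and off-diagonal blocks r and B has two
    block triangular factorizations; comparing the determinants gives the formula. *)
Lemma det_1_sub_rank1 (R : comPzRingType) n (B : 'cV[R]_n) (r : 'rV[R]_n) :
  \det (1%:M - B *m r) = 1 - (r *m B) 0 0.
Proof.
have H1 : block_mx 1%:M r B 1%:M =
    block_mx 1%:M 0 B 1%:M *m block_mx 1%:M r 0 (1%:M - B *m r) :> 'M[R]_(1 + n, 1 + n).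
  rewrite mulmx_block !mulmx1 !mul1mx !(mul0mx, mulmx0) !addr0.
  by rewrite addrC subrK.
have H2 : block_mx 1%:M r B 1%:M =
    block_mx (1%:M - r *m B) r 0 1%:M *m block_mx 1%:M 0 B 1%:M :> 'M[R]_(1 + n, 1 + n).
  rewrite mulmx_block !mulmx1 !mul1mx !(mul0mx, mulmx0) !add0r.
  by rewrite subrK.
have := congr1 determinant H1; rewrite H2 !det_mulmx !det_lblock !det_ublock.
by rewrite !det1 !mul1r !mulr1 det_mx11 !mxE /= => <-.
Qed.

Section rotation_formula.
Context {R : realType} {N : nat}.
Implicit Types (u v w e y : 'rV[R]_N).

Lemma gram_decomposition e u v : enorm e = 1 -> enorm u = 1 ->
  1 - dotv e u ^+ 2 != 0 ->
  exists w (b c : R), [/\ v = w + b *: e + c *: u, dotv w e = 0 & dotv w u = 0].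
Proof.
move=> /enorm1_dotv e1 /enorm1_dotv u1; set d := dotv e u => d1.
pose b := (dotv v e - d * dotv v u) / (1 - d ^+ 2).
pose c := (dotv v u - d * dotv v e) / (1 - d ^+ 2).
exists (v - b *: e - c *: u), b, c; split.
- by rewrite addrAC !subrK.
- rewrite !dotvE e1 (dotvC u e) -/d /b /c; field; exact: d1.
- rewrite !dotvE u1 -/d /b /c; field; exact: d1.
Qed.

(** Since M preserves dot products, u *m M is a unit vector of the plane of e and u that
    makes with u the same angle as e. This leaves two cases: M rotates the plane, or it
    swaps e and u. In the second case M is a reflection, of determinant -1. *)
Lemma rotation_planeE (M : 'M[R]_N) e u :
  rotation M -> enorm e = 1 -> enorm u = 1 -> e *m M = u -> u != - e ->
  u != e -> (forall v, dotv v e = 0 -> dotv v u = 0 -> v *m M = v) ->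
  forall v, v *m M = v - (dotv v (e + u) / (1 + dotv e u)) *: (e + u)
                     + (2 * dotv v e) *: u.
Proof.
move=> rM e1 u1 eM uNe ue fixM.
have ee := enorm1_dotv e1; have uu := enorm1_dotv u1.
set d := dotv e u.
have dN1 : 1 + d != 0.
  apply: contra_neq uNe => d0; apply/eqP; rewrite -subr_eq0 opprK -dotvv_eq0.
  rewrite !dotvE ee uu (dotvC u e) -/d; apply/eqP; lra.
have d1 : 1 - d != 0.
  apply: contra_neq ue => d0; apply/eqP; rewrite -subr_eq0 -dotvv_eq0.
  rewrite !dotvE ee uu (dotvC u e) -/d; apply/eqP; lra.
have dd : 1 - d ^+ 2 != 0.
  by rewrite -(expr1n _ 2) subr_sqr mulf_neq0.
set y := u *m M.
have yu : dotv y u = d by rewrite -[in X in dotv _ X]eM dotv_rotation// dotvC.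
have yy : dotv y y = 1 by rewrite dotv_rotation.
have [w [b [c [yE we wu]]]] := gram_decomposition y e1 u1 dd.
have w0 : w = 0.
  apply/eqP; rewrite -dotvv_eq0.
  have : dotv w y = dotv w w by rewrite yE !dotvE we wu; ring.
  by move=> <-; rewrite /y -[in X in dotv X _](fixM w)// dotv_rotation// wu.
rewrite w0 add0r in yE.
have hc : b * d + c = d by rewrite -[RHS]yu yE !dotvE uu -/d mulr1.
have hy : b ^+ 2 + c ^+ 2 + 2 * b * c * d = 1.
  by rewrite -[RHS]yy yE !dotvE ee uu (dotvC u e) -/d; ring.
have cE : c = d - b * d by rewrite -[in X in X - _]hc addrAC subrr add0r.
have : (b - 1) * (b + 1) = 0.
  have : (b ^+ 2 - 1) * (1 - d ^+ 2) = 0 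
    by transitivity (b ^+ 2 + c ^+ 2 + 2 * b * c * d - 1); [rewrite cE; ring | rewrite hy subrr].
  by move=> /eqP; rewrite mulf_eq0 (negbTE dd) orbF => /eqP <-; ring.
move=> /eqP; rewrite mulf_eq0 => /orP[/eqP b1|/eqP b1]; last first.
  have bE : b = -1 by lra.
  have uM : u *m M = - e + (2 * d) *: u.
    by rewrite -/y yE cE bE scaleN1r; congr (_ + _ *: _); ring.
  move=> v; have [w' [b' [c' [vE we' wu']]]] := gram_decomposition v e1 u1 dd.
  rewrite [in LHS]vE !mulmxDl -!scalemxAl eM uM fixM//.
  have -> : dotv v e = b' + c' * d.
    by rewrite vE !dotvE ee we' (dotvC u e) -/d; ring.
  have -> : dotv v (e + u) / (1 + d) = b' + c'.
    rewrite vE !dotvE ee uu we' wu' (dotvC u e) -/d; field; exact: dN1.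
  by rewrite vE; apply/rowP => i; rewrite !mxE; ring.
(* M swaps e and u, hence is the reflection in the hyperplane orthogonal to e - u. *)
have bE : b = 1 by lra.
have uM : u *m M = e.
  by rewrite -/y yE cE bE scale1r mul1r subrr scale0r addr0.
exfalso.
have nn : dotv (e - u) (e - u) = 2 * (1 - d).
  by rewrite !dotvE ee uu (dotvC u e) -/d; ring.
have ME : M = 1%:M - (((1 - d)^-1 *: (e - u)^T) *m (e - u)).
  apply/row_matrixP => i; rewrite !rowE.
  set v := delta_mx _ _.
  have [w' [b' [c' [vE we' wu']]]] := gram_decomposition v e1 u1 dd.
  have vn : v *m (e - u)^T = ((b' - c') * (1 - d))%:M.
    apply/matrixP => a1 a2; rewrite !ord1 -dotv_mx [in RHS]mxE eqxx mulr1n.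
    by rewrite vE !dotvE ee uu we' wu' (dotvC u e) -/d; ring.
  rewrite mulmxBr mulmx1 -scalemxAl -scalemxAr mulmxA vn mul_scalar_mx scalerA.
  rewrite (_ : (1 - d)^-1 * _ = b' - c'); last by field.
  rewrite [in LHS]vE !mulmxDl -!scalemxAl eM uM fixM// [in RHS]vE.
  by apply/rowP => j; rewrite !mxE; ring.
have [_] := rM; rewrite ME det_1_sub_rank1 -scalemxAr mxE -dotv_mx nn.
by rewrite mulrCA mulVf// mulr1 => ?; lra.
Qed.

(** A rotation family is a rational expression of its target u away from u = - e, and the
    arbitrary choice made at u = - e concerns one matrix. The measurability of the game
    rests on this. *)
Lemma rotation_familyE (rot : 'rV[R]_N -> 'rV[R]_N -> 'M[R]_N) u e v :
  is_rotation_family rot -> enorm e = 1 -> enorm u = 1 -> u != - e ->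
  v *m rot u e = v - (dotv v (e + u) / (1 + dotv e u)) *: (e + u)
                     + (2 * dotv v e) *: u.
Proof.
move=> hrot e1 u1 uNe; have [rM eM r1 fixM] := hrot _ _ u1 e1.
have [ue|ue] := eqVneq u e.
  rewrite r1// mulmx1 ue dotvDr (enorm1_dotv e1).
  by apply/rowP => i; rewrite !mxE; field.
by apply: rotation_planeE => //; exact: fixM.
Qed.

End rotation_formula.

(** * Lebesgue measure on row vectors *)

Section lebesgue_rV_theory.
Context {R : realType}.

Definition flipv n (sg : 'I_n -> bool) (v : 'rV[R]_n) : 'rV[R]_n :=
  \row_i ((-1) ^+ sg i * v 0 i).

Lemma measurable_flipv n (sg : 'I_n -> bool) : measurable_fun setT (flipv sg).
Proof.
apply: measurable_fun_rVP => i; under eq_fun do rewrite mxE.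
by apply: measurable_funM => //; exact: measurable_coord.
Qed.

Lemma measurable_preimage d1 d2 (T1 : measurableType d1) (T2 : measurableType d2)
    (f : T1 -> T2) (A : set T2) :
  measurable_fun setT f -> measurable A -> measurable (f @^-1` A).
Proof. by move=> mf mA; rewrite -[X in measurable X]setTI; exact: mf. Qed.

Lemma lebesgue_measure_sign (b : bool) (A : set R) : measurable A ->
  @lebesgue_measure R ((fun x : R => (-1) ^+ b * x) @^-1` A) = lebesgue_measure A.
Proof.
move=> mA; case: b => /=.
  rewrite -[RHS]lebesgue_measureN// /pushforward; congr (lebesgue_measure _).
  by apply/funext => x /=; rewrite expr1 mulN1r.
by congr (lebesgue_measure _); apply/funext => x /=; rewrite expr0 mul1r.
Qed.

Lemma lebesgue_rVS n (A : set 'rV[R]_n.+1) : lebesgue_rV n.+1 A =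
  (@lebesgue_measure R \x lebesgue_rV n)%E (@consrV R n @^-1` A).
Proof. by []. Qed.

(** By induction on the dimension: a product of measures that are invariant under a change
    of sign agrees on rectangles with its image under changes of sign. *)
Lemma lebesgue_rV_flip n (sg : 'I_n -> bool) (A : set 'rV[R]_n) :
  measurable A -> lebesgue_rV n (flipv sg @^-1` A) = lebesgue_rV n A.
Proof.
elim: n => [|n IHn] in sg A *; move=> mA.
  by congr (lebesgue_rV 0 _); apply/funext => v /=; rewrite (thinmx0 (flipv sg v)) (thinmx0 v).
pose sg' (j : 'I_n) := sg (lift ord0 j).
pose f (p : measurableTypeR R * 'rV[R]_n) : measurableTypeR R * 'rV[R]_n :=
  ((-1) ^+ (sg ord0) * p.1, flipv sg' p.2).
have mf : measurable_fun setT f.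
  apply/measurable_fun_pairP; split => /=.
    by apply: measurable_funM => //; exact: measurable_fst.
  by apply: (measurableT_comp (measurable_flipv sg')); exact: measurable_snd.
have mB : measurable (@consrV R n @^-1` A).
  exact: (measurable_preimage (@measurable_consrV R n)).
have fE : @consrV R n \o f = flipv sg \o @consrV R n.
  apply/funext => -[x v]; apply/rowP => i; rewrite /f /consrV /=.
  by case: (unliftP ord0 i) => [j ->|->] /=; rewrite !mxE ?liftK ?unlift_none /= ?mxE.
pose m' : {measure set (measurableTypeR R * 'rV[R]_n) -> \bar R} :=
  pushforward (@lebesgue_measure R \x lebesgue_rV n)%E f.
have preE : @consrV R n @^-1` (flipv sg @^-1` A) = f @^-1` (@consrV R n @^-1` A).
  by apply/seteqP; split => p /=; have /= -> := congr1 (fun g => g p) fE.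
rewrite !lebesgue_rVS preE.
apply/esym/(@product_measure_unique _ _ _ _ R lebesgue_measure (lebesgue_rV n) (m' mf)) => //.
move=> B C mB' mC; rewrite /m' /= /pushforward.
have -> : f @^-1` (B `*` C) =
    ((fun x : R => (-1) ^+ (sg ord0) * x) @^-1` B) `*` (flipv sg' @^-1` C) by [].
rewrite product_measure1E; last 2 first.
- by rewrite -[X in measurable X]setTI; apply: measurable_funM.
- exact: (measurable_preimage (measurable_flipv sg') mC).
by congr (_ * _)%E; [exact: lebesgue_measure_sign | exact: IHn].
Qed.

Definition cube n (c : 'rV[R]_n) (r : R) : set 'rV[R]_n :=
  [set v | forall i, `|v 0 i - c 0 i| <= r].

Lemma measurable_cube n (c : 'rV[R]_n) (r : R) : measurable (cube c r).
Proof.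
have -> : cube c r = \bigcap_(i in [set: 'I_n])
    ((fun v : 'rV[R]_n => v 0 i) @^-1` `[c 0 i - r, c 0 i + r]%classic).
  apply/seteqP; split => [v H i _|v H i] /=.
    by rewrite in_itv/= -ler_distl H.
  by have := H i I; rewrite /= in_itv/= -ler_distl.
apply: fin_bigcap_measurable; first by [].
move=> i _; rewrite -[X in measurable X]setTI.
by apply: measurable_coord => //; exact: measurable_itv.
Qed.

Lemma lebesgue_rV_cube n (c : 'rV[R]_n) (r : R) : 0 <= r ->
  lebesgue_rV n (cube c r) = ((2 * r) ^+ n)%:E.
Proof.
move=> r0; elim: n => [|n IHn] in c *.
  rewrite /= expr0 diracE mem_set// => -[] //.
pose c' := \row_j c 0 (lift ord0 j) : 'rV[R]_n.
have mcube := measurable_cube c' r.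
rewrite lebesgue_rVS (_ : @consrV R n @^-1` cube c r =
    `[c 0 ord0 - r, c 0 ord0 + r] `*` cube c' r); last first.
  apply/seteqP; split => [[x v] H|[x v] [/= H1 H2] i].
    split => [|i] /=.
      by have := H ord0; rewrite /consrV mxE unlift_none/= in_itv/= ler_distl.
    by have := H (lift ord0 i); rewrite /consrV mxE liftK/= mxE.
  rewrite /consrV mxE /=; case: (unliftP ord0 i) => [j ->|->].
    by have := H2 j; rewrite mxE.
  by move: H1; rewrite in_itv/= ler_distl.
rewrite product_measure1E//= IHn lebesgue_measure_itv/= lte_fin.
case: ltP => h.
  by rewrite -EFinB -EFinM exprS; congr (_ * _)%:E; ring.
rewrite (_ : r = 0); last by lra.
by rewrite mul0e mulr0 expr0n.
Qed.

Lemma measurable_shift n (c : 'rV[R]_n) : measurable_fun setT (fun q : 'rV[R]_n => q - c).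
Proof.
apply: measurable_fun_rVP => i; under eq_fun do rewrite !mxE.
by apply: measurable_funB => //; exact: measurable_coord.
Qed.

End lebesgue_rV_theory.

(** * Integrals over dyadic shells and the Gamma function *)

Section shells.
Local Open Scope ereal_scope.
Context d (T : measurableType d) (R : realType).
Variable mu : {measure set T -> \bar R}.

Lemma nneseries_geometric_le (u : nat -> \bar R) (C q : R) :
  (0 <= q < 1)%R -> (0 <= C)%R -> (forall k, 0 <= u k) -> (forall k, u k <= (C * q ^+ k)%:E) ->
  \sum_(k <oo) u k <= (C / (1 - q))%:E.
Proof.
move=> /andP[q0 q1] C0 u0 uC.
have q1' : (1 - q != 0)%R by rewrite subr_eq0 gt_eqF.
apply: lime_le; first by apply: is_cvg_nneseries => n _ _; exact: u0.
apply: nearW => n.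
apply: (@le_trans _ _ (\sum_(0 <= k < n) (C * q ^+ k)%:E)).
  by apply: lee_sum => k _; exact: uC.
rewrite sumEFin lee_fin.
have -> : (\sum_(0 <= k < n) C * q ^+ k = C * (1 - q ^+ n) / (1 - q))%R.
  have := @geometric_seriesE R C q (negbT (lt_eqF q1)).
  by move=> /(congr1 (fun f => f n)).
rewrite ler_pM2r ?invr_gt0 ?subr_gt0// ler_piMr//.
by rewrite gerBl exprn_ge0.
Qed.

(** The Gamma function and the mean cost of a step are bounded in this way: a k bounds the
    integrand on the k-th shell, and its product with the mass of the shell decays
    geometrically. *)
Lemma integral_le_shells (D : set T) (f : T -> \bar R) (S : nat -> set T)
    (a : nat -> R) (C q : R) :
  measurable D -> measurable_fun D f -> (forall x, D x -> 0 <= f x) ->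
  (forall k, measurable (S k)) -> (D `<=` \bigcup_k S k) ->
  (forall k, 0 <= a k)%R -> (forall k x, D x -> S k x -> f x <= (a k)%:E) ->
  (0 <= q < 1)%R -> (0 <= C)%R ->
  (forall k, (a k)%:E * mu (S k) <= (C * q ^+ k)%:E) ->
  \int[mu]_(x in D) f x <= (C / (1 - q))%:E.
Proof.
move=> mD mf f0 mS DS a0 fa q01 C0 aC.
have ma k : measurable_fun D (fun x => (a k)%:E * (\1_(S k) x)%:E).
  by apply: measurable_funeM; apply/measurable_EFinP; exact: measurable_indic.
have aS0 k x : D x -> 0 <= (a k)%:E * (\1_(S k) x)%:E.
  by move=> _; rewrite mule_ge0// lee_fin.
apply: (@le_trans _ _ (\int[mu]_(x in D) (\sum_(k <oo) (a k)%:E * (\1_(S k) x)%:E))).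
  apply: ge0_le_integral => //.
  - by apply: ge0_emeasurable_sum => // k x Dx _; exact: aS0.
  move=> x Dx; have [k _ Skx] := DS _ Dx.
  apply: le_trans (nneseries_lim_ge k.+1 _); last by move=> *; exact: aS0.
  rewrite big_nat_recr//= indicE mem_set// mule1.
  by apply: (le_trans (fa _ _ Dx Skx)); rewrite leeDr// sume_ge0// => i _; exact: aS0.
rewrite integral_nneseries//.
apply: nneseries_geometric_le => // k; first by apply: integral_ge0 => x Dx; exact: aS0.
rewrite ge0_integralZl_EFin//; last first.
  by apply/measurable_EFinP; exact: measurable_indic.
rewrite integral_indic//; apply: le_trans (aC k).
by apply: lee_wpmul2l; [rewrite lee_fin | apply: le_measure; rewrite ?inE//; exact: measurableI].
Qed.

End shells.

Lemma dyadic_le (R : realType) (x : R) : 1 <= x ->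
  exists k : nat, 2 ^+ k <= x < 2 ^+ k.+1.
Proof.
move=> x1; pose P k := (2 ^+ k <= x).
have xN : exists n : nat, x < n%:R by exists (Num.truncn x).+1; exact: truncnS_gt.
have [n xn] := xN.
have Pbound k : P k -> (k <= n)%N.
  move=> Pk; rewrite leqNgt; apply/negP => nk.
  have : (n%:R : R) < 2 ^+ k.
    by rewrite -natrX ltr_nat (leq_trans nk)// ltnW// ltn_expl.
  by rewrite ltNge => /negP; apply; rewrite (le_trans Pk)// ltW.
have exP : exists k, P k by exists 0%N; rewrite /P expr0.
have [k Pk kmax] := ex_maxnP exP Pbound.
exists k; rewrite -/(P k) Pk /= ltNge; apply/negP => Pk1.
by have := kmax _ Pk1; rewrite ltnn.
Qed.

(** The (n+1)-st power of exp (t / (n+1)) >= t / (n+1). *)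
Lemma expRN_le_powerV (R : realType) (n : nat) (t : R) : 0 < t ->
  expR (- t) <= (n.+1%:R / t) ^+ n.+1.
Proof.
move=> t0; have n0 : 0 < n.+1%:R :> R by [].
rewrite expRN -[leRHS]invrK lef_pV2 ?posrE ?expR_gt0 ?invr_gt0 ?exprn_gt0 ?divr_gt0//.
have -> : expR t = expR (t / n.+1%:R) ^+ n.+1.
  by rewrite -expRM_natl mulrC divfK// gt_eqF.
rewrite -exprVn invf_div lerXn2r ?nnegrE ?expR_ge0 ?divr_ge0 ?ltW//.
by rewrite (le_lt_trans _ (expR_gt1Dx _))// ?lerDr// gt_eqF ?divr_gt0.
Qed.

Lemma pow2N_lt1 (R : realType) (x : R) : 0 < x -> 0 <= (2 : R) `^ (- x) < 1.
Proof.
move=> x0; rewrite powR_ge0/= /powR gt_eqF// -[ltRHS]expR0 ltr_expR mulNr oppr_lt0.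
by rewrite mulr_gt0// ln_gt0// ltr1n.
Qed.

Section Gamma_gt0.
Context {R : realType}.

Let g (x t : R) := t `^ (x - 1) * expR (- t).

Let mg x (D : set R) : measurable_fun D (EFin \o g x).
Proof.
apply/measurable_EFinP; apply: measurable_funTS; apply: measurable_funM.
  exact: measurable_powR.
by apply: measurableT_comp => //; exact: measurable_funN.
Qed.

Lemma powR_dyadic_geometric (x : R) k : (2 : R) `^ (- x * k%:R) = (2 `^ (- x)) ^+ k.
Proof. by rewrite -powR_mulrn ?powR_ge0// -powRrM. Qed.

Lemma Gamma_integral_fin (x : R) : 0 < x ->
  (\int[lebesgue_measure]_(t in `]0%R, +oo[) (g x t)%:E < +oo)%E.
Proof.
move=> x0; have g0 t : 0 <= g x t by rewrite mulr_ge0 ?powR_ge0 ?expR_ge0.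
have -> : `]0, +oo[%classic = `]0, 1] `|` `]1, +oo[ :> set R.
  apply/seteqP; split => t /=; rewrite !in_itv/= ?andbT.
    by move=> ->/=; case: (leP t 1); [left|right].
  by move=> [/andP[]|/(lt_trans ltr01)].
rewrite ge0_integral_setU; [ | by [] | by [] | exact: mg | | ]; last 2 first.
- by move=> t _; rewrite lee_fin.
- apply/disj_setPS => t /=; rewrite !in_itv/= andbT => -[/andP[_ t1]].
  by rewrite ltNge t1.
have q1 := pow2N_lt1 x0.
apply: lte_add_pinfty.
- (* On ]2^-(k+1), 2^-k] the integrand is at most 2^(- k x) 2^(k+1). *)
  apply: le_lt_trans (ltry (1 / (1 - 2 `^ (- x)))).
  pose S (k : nat) : set R := `](2 ^+ k.+1)^-1, (2 ^+ k)^-1]%classic.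
  have := @integral_le_shells _ _ _ (@lebesgue_measure R) `]0%R, 1%R]%classic (EFin \o g x) S
    (fun k => (2 `^ (- x)) ^+ k * 2 ^+ k.+1) 1 (2 `^ (- x)); apply; [by [] | exact: mg
    | by move=> t _; rewrite lee_fin | by move=> k; exact: measurable_itv | | | | by [] | by [] | ].
  + move=> t /=; rewrite in_itv/= => /andP[t0 t1].
    have [|k /andP[k1 k2]] := @dyadic_le R t^-1; first by rewrite invf_ge1.
    exists k => //; rewrite /S/= in_itv/= -[t]invrK ltf_pV2 ?lef_pV2 ?posrE ?invr_gt0//.
      by rewrite k1 k2.
  + by move=> k; rewrite mulr_ge0 ?exprn_ge0 ?powR_ge0.
  + move=> k t _; rewrite /S/= in_itv/= => /andP[t1 t2]; rewrite lee_fin.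
    have t0 : 0 < t by rewrite (le_lt_trans _ t1)// invr_ge0 exprn_ge0.
    rewrite /g powRB; last by rewrite (gt_eqF t0) implybT.
    rewrite powRr1 ?(ltW t0)// -[leRHS]mulr1; apply: ler_pM => //.
    * by rewrite divr_ge0 ?powR_ge0// ltW.
    * apply: ler_pM => //; rewrite ?powR_ge0 ?invr_ge0 ?(ltW t0)//.
        rewrite -powR_dyadic_geometric mulNr mulrC -mulNr powRrM.
        rewrite ge0_ler_powR ?(ltW x0)// ?nnegrE ?(ltW t0) ?powR_ge0//.
        by rewrite (le_trans t2)// powRN powR_mulrn.
      by rewrite -[leRHS]invrK lef_pV2 ?posrE ?invr_gt0 ?exprn_gt0// ltW.
    * by rewrite -[leRHS]expR0 ler_expR oppr_le0 ltW.
  + move=> k; rewrite /S/= lebesgue_measure_itv/= lte_fin.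
    have k0 : 0 < (2 : R) ^+ k by rewrite exprn_gt0.
    case: ifPn => _; last by rewrite mule0 lee_fin mulr_ge0// exprn_ge0// powR_ge0.
    rewrite -EFinB -EFinM lee_fin mul1r -mulrA ler_piMr ?exprn_ge0 ?powR_ge0//.
    by rewrite (_ : _ * (_ - _) = 1)// exprS; field; rewrite gt_eqF.
- (* On [2^k, 2^(k+1)[ the decay of the exponential beats every power. *)
  have [m mx] : exists m : nat, x - 1 <= m%:R.
    by exists (Num.truncn (x - 1)).+1; exact/ltW/truncnS_gt.
  pose c : R := m.+2%:R ^+ m.+2.
  have c0 : 0 <= c by rewrite exprn_ge0.
  apply: le_lt_trans (ltry (c / (1 - 2^-1))).
  pose S (k : nat) : set R := `[2 ^+ k, 2 ^+ k.+1[%classic.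
  have := @integral_le_shells _ _ _ (@lebesgue_measure R) `]1%R, +oo[%classic (EFin \o g x) S
    (fun k => c / (2 ^+ k) ^+ 2) c 2^-1; apply; [by [] | exact: mg
    | by move=> t _; rewrite lee_fin | by move=> k; exact: measurable_itv | | | | | by [] | ].
  + move=> t /=; rewrite in_itv/= andbT => t1.
    have [k kt] := dyadic_le (ltW t1).
    by exists k => //; rewrite /S/= in_itv/=.
  + by move=> k; rewrite divr_ge0// !exprn_ge0.
  + move=> k t; rewrite /S/= !in_itv/= andbT => t1 /andP[kt _]; rewrite lee_fin.
    have t0 : 0 < t by rewrite (lt_trans ltr01).
    have k0 : 0 < (2 : R) ^+ k by rewrite exprn_gt0.
    apply: (@le_trans _ _ (t ^+ m * (m.+2%:R / t) ^+ m.+2)).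
      apply: ler_pM; rewrite ?powR_ge0 ?expR_ge0//.
        by rewrite -powR_mulrn ?(ltW t0)// ler_powR// ltW.
      exact: expRN_le_powerV.
    have -> : t ^+ m * (m.+2%:R / t) ^+ m.+2 = c / t ^+ 2.
      rewrite expr_div_n -/c -addn2 exprD; field.
      by rewrite gt_eqF//= expf_neq0// gt_eqF.
    rewrite ler_wpM2l// lef_pV2 ?posrE ?exprn_gt0//.
    by rewrite lerXn2r// nnegrE ltW.
  + by rewrite invr_ge0 invf_lt1 ?ltr1n// ler0n.
  + move=> k; rewrite /S/= lebesgue_measure_itv/= lte_fin.
    have k0 : 0 < (2 : R) ^+ k by rewrite exprn_gt0.
    case: ifPn => _; last by rewrite mule0 lee_fin mulr_ge0// exprn_ge0// invr_ge0.
    rewrite -EFinB -EFinM lee_fin exprVn (exprS 2 k) le_eqVlt; apply/orP; left; apply/eqP.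
    by field; rewrite gt_eqF.
Qed.

(** Gamma is the real part of an extended integral, so it would vanish if the integral were
    infinite: positivity needs the previous bound. It makes the constant of the fractional
    measure positive, without which the step law would not be a normalization. *)
Lemma Gamma_gt0 (x : R) : 0 < x -> 0 < Gamma x.
Proof.
move=> x0; have g0 t : 0 <= g x t by rewrite mulr_ge0 ?powR_ge0 ?expR_ge0.
rewrite /Gamma /Rintegral fine_gt0// Gamma_integral_fin// andbT.
pose c := Num.min 1 (2 `^ (x - 1)) * expR (- 2).
have c0 : 0 < c by rewrite mulr_gt0 ?expR_gt0// lt_min ltr01 powR_gt0.
apply: (@lt_le_trans _ _ (\int[lebesgue_measure]_(t in `]1%R, 2%R]) c%:E)%E).
  rewrite integral_cst//= lebesgue_measure_itv/= lte_fin ltr1n.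
  by rewrite -EFinB -EFinM lte_fin mulr_gt0// subr_gt0 ltr1n.
apply: (@le_trans _ _ (\int[lebesgue_measure]_(t in `]1%R, 2%R]) (g x t)%:E)%E).
  apply: ge0_le_integral => //.
  - by move=> t _; rewrite lee_fin ltW.
  - exact: mg.
  move=> t /=; rewrite in_itv/= => /andP[t1 t2]; rewrite lee_fin.
  have t0 : 0 < t by rewrite (lt_trans ltr01).
  apply: ler_pM; rewrite ?expR_ge0//.
  - have [x1|x1] := leP 1 x.
      rewrite ge_min; apply/orP; left; rewrite -[leLHS](powRr0 t).
      by apply: ler_powR; [exact: ltW | rewrite subr_ge0].
    rewrite ge_min; apply/orP; right.
    rewrite -(opprB 1 x) !powRN lef_pV2 ?posrE ?powR_gt0//.
    by rewrite ge0_ler_powR ?nnegrE ?subr_ge0 ?(ltW x1) ?(ltW t0).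
  - by rewrite ler_expR lerN2.
apply: ge0_subset_integral => //.
- exact: mg.
- by move=> t _; rewrite lee_fin.
- move=> t /=; rewrite !in_itv/= andbT => /andP[t1 _]; exact: lt_trans t1.
Qed.

End Gamma_gt0.

(** * The Riesz measure of annuli and cubes *)

Section riesz_bounds.
Context {R : realType} (N : nat) (s : R).
Hypothesis s0 : 0 < s.
Local Notation rz := (@riesz_measure R N s).

Definition annulus (r : R) : set 'rV[R]_N := [set z | r <= enorm z <= 2 * r].

Lemma measurable_annulus r : measurable (annulus r).
Proof.
rewrite (_ : annulus r = @enorm R N @^-1` `[r, 2 * r]%classic).
  exact: (measurable_preimage measurable_enorm).
by apply/seteqP; split => z /=; rewrite in_itv.
Qed.

Lemma coord_le_enorm (z : 'rV[R]_N) i : `|z 0 i| <= enorm z.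
Proof.
rewrite -sqrtr_sqr /enorm ler_sqrt ?dotvv_ge0// /dotv (bigD1 i)//= -expr2 lerDl.
by apply: sumr_ge0 => j _; rewrite -expr2 sqr_ge0.
Qed.

Lemma enorm_le_cube (z : 'rV[R]_N) r : 0 <= r -> (forall i, `|z 0 i| <= r) ->
  enorm z <= N%:R * r.
Proof.
move=> r0 zr; rewrite -(ler_pXn2r (n := 2)) ?nnegrE ?mulr_ge0 ?enorm_ge0 ?ler0n//.
rewrite enorm_sqr exprMn /dotv.
apply: (@le_trans _ _ (\sum_(i < N) r ^+ 2)).
  apply: ler_sum => i _; rewrite -expr2 -real_normK ?num_real//.
  by rewrite lerXn2r ?nnegrE// zr.
rewrite sumr_const card_ord -[leLHS]mulr_natl ler_wpM2r ?sqr_ge0// -natrX ler_nat.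
by case: N => // n; rewrite expnS expn1 leq_pmulr.
Qed.

Lemma powR_scale (r : R) : 0 < r ->
  (r `^ (N%:R + 2 * s))^-1 * r ^+ N = r `^ (- (2 * s)).
Proof.
move=> r0; rewrite powRD; last by rewrite (gt_eqF r0) implybT.
by rewrite powR_mulrn ?ltW// powRN; field; rewrite !gt_eqF ?powR_gt0 ?exprn_gt0.
Qed.

Let expo_ge0 : 0 <= N%:R + 2 * s :> R.
Proof. by rewrite addr_ge0 ?mulr_ge0// ltW. Qed.

(** The density is at most r ^ - (N + 2 s) on the annulus, which lies in a cube of side
    4 r: the dimension cancels. *)
Lemma riesz_annulus_le (r : R) : 0 < r ->
  (rz (annulus r) <= (4 ^+ N * r `^ (- (2 * s)))%:E)%E.
Proof.
move=> r0; have mA := measurable_annulus r.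
apply: (@le_trans _ _ (\int[lebesgue_rV N]_(z in annulus r) ((r `^ (N%:R + 2 * s))^-1)%:E)%E).
  apply: ge0_le_integral => //.
  - by move=> z _; rewrite lee_fin riesz_density_ge0.
  - by apply/measurable_EFinP; apply: measurable_funTS; exact: measurable_riesz_density.
  move=> z /= /andP[rz _]; rewrite lee_fin /riesz_density.
  have z0 : 0 < enorm z by exact: lt_le_trans rz.
  by rewrite lef_pV2 ?posrE ?powR_gt0// ge0_ler_powR ?nnegrE ?(ltW r0) ?(ltW z0) ?expo_ge0.
rewrite integral_cst//.
apply: (@le_trans _ _ (((r `^ (N%:R + 2 * s))^-1)%:E * ((2 * (2 * r)) ^+ N)%:E)%E).
  apply: lee_wpmul2l; first by rewrite lee_fin invr_ge0 powR_ge0.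
  rewrite -(lebesgue_rV_cube 0); last by rewrite mulr_ge0// ltW.
  apply: le_measure; rewrite ?inE; [exact: mA | exact: measurable_cube | ].
  move=> z /andP[_ z2] i; rewrite mxE subr0; exact: (le_trans (coord_le_enorm z i)) z2.
rewrite -EFinM lee_fin mulrA exprMn mulrCA powR_scale// (_ : 2 * 2 = 4)//.
by rewrite -natrM.
Qed.

Lemma riesz_cube_ge (c : 'rV[R]_N) (r M : R) : 0 <= r ->
  (forall z, cube c r z -> 0 < enorm z <= M) ->
  (((M `^ (N%:R + 2 * s))^-1 * (2 * r) ^+ N)%:E <= rz (cube c r))%E.
Proof.
move=> r0 cM; rewrite EFinM -(lebesgue_rV_cube c r0) -integral_cst; last exact: measurable_cube.
apply: ge0_le_integral => //; first exact: measurable_cube.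
- by move=> z _; rewrite lee_fin invr_ge0 powR_ge0.
- by apply/measurable_EFinP; apply: measurable_funTS; exact: measurable_riesz_density.
move=> z /cM /andP[z0 zM]; rewrite lee_fin /riesz_density.
have M0 := lt_le_trans z0 zM.
by rewrite lef_pV2 ?posrE ?powR_gt0// ge0_ler_powR ?nnegrE ?(ltW z0) ?(ltW M0) ?expo_ge0.
Qed.

Lemma riesz_flip (sg : 'I_N -> bool) (A : set 'rV[R]_N) : measurable A ->
  rz (flipv sg @^-1` A) = rz A.
Proof.
move=> mA; rewrite /riesz_measure.
have dE z : riesz_density s (flipv sg z) = riesz_density s z :> R.
  rewrite /riesz_density /enorm /dotv; congr ((Num.sqrt _ `^ _)^-1).
  apply: eq_bigr => i _; rewrite !mxE mulrACA -expr2 -exprM mulnC exprM sqrrN.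
  by rewrite !expr1n mul1r.
transitivity (\int[lebesgue_rV N]_(z in flipv sg @^-1` A)
    ((EFin \o riesz_density s) \o flipv sg) z)%E.
  by apply: eq_integral => z _ /=; rewrite dE.
rewrite -(ge0_integral_pushforward (measurable_flipv sg))//; last 2 first.
- by apply/measurable_EFinP; apply: measurable_funTS; exact: measurable_riesz_density.
- by move=> z _; rewrite lee_fin riesz_density_ge0.
apply: eq_measure_integral => [|mf B mB BA]; first exact: measurable_flipv.
by rewrite -[RHS](lebesgue_rV_flip sg).
Qed.

End riesz_bounds.

(** * The step law near its axis *)

Section angles.
Context {R : realType} {N : nat}.
Implicit Types (u z : 'rV[R]_N).

Lemma angle_lt_dotv u z (a : R) : 0 <= a <= pi ->
  cos a < dotv u z / (enorm u * enorm z) -> angle u z < a.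
Proof.
move=> /andP[a0 api] h; rewrite /angle.
have [acos0 acosE] := acos_def (angle_cos_bound u z).
by rewrite -ltr_cos ?in_itv//= ?a0 // acosE.
Qed.

Lemma aperture_ratio (a : R) : 0 < a <= pi / 2 ->
  exists2 rho : R, 0 < rho <= 2^-1 & cos a < (1 - rho) / (1 + rho).
Proof.
move=> /andP[a0 api]; have pi0 := pi_gt0 R.
have c1 : cos a < 1.
  by rewrite -cos0 ltr_cos ?in_itv/= ?lexx ?(ltW a0) ?(ltW pi0)//=; lra.
have c0 := cos_geN1 a.
exists ((1 - cos a) / 4); first by apply/andP; split; lra.
by rewrite ltr_pdivlMr; [nra | lra].
Qed.

(** The cosine is at least (1 - rho) / (1 + rho) at relative distance rho from a point of
    the axis. Cones are handled below only through this criterion, which is stable under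
    rotations and translations along the axis. *)
Lemma angle_near_axis u z (a rho t : R) : 0 <= a <= pi -> enorm u = 1 ->
  0 < t -> 0 < rho <= 2^-1 -> cos a < (1 - rho) / (1 + rho) ->
  enorm (z - t *: u) <= rho * t ->
  [/\ angle u z < a, t / 2 <= enorm z & enorm z <= 2 * t].
Proof.
move=> a0 u1 t0 /andP[r0 r1] car zt.
have zE : z = t *: u + (z - t *: u) by rewrite addrC subrK.
have zle : enorm z <= (1 + rho) * t.
  rewrite [in leLHS]zE (le_trans (ler_enormD _ _))// enormZ u1 gtr0_norm//; lra.
have uz : (1 - rho) * t <= dotv u z.
  rewrite {1}zE dotvDr dotvZr (enorm1_dotv u1).
  have := dotv_le (- u) (z - t *: u); rewrite dotvNl enormN u1; lra.
have zge : (1 - rho) * t <= enorm z.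
  by have := dotv_le u z; rewrite u1 mul1r; exact: le_trans.
have z0 : 0 < enorm z by apply: lt_le_trans zge; nra.
split; [|nra|nra].
apply: angle_lt_dotv => //; rewrite u1 mul1r; apply: lt_le_trans car _.
rewrite ler_pdivlMr// mulrAC ler_pdivrMr; last lra.
by nra.
Qed.

End angles.

Section step_law_bounds.
Context {R : realType} (N : nat) (s a : R).
Hypothesis N0 : (0 < N)%N.
Hypothesis hs : 2^-1 < s < 1.
Hypothesis a0 : 0 < a <= pi / 2.
Local Notation rz := (@riesz_measure R N s).
Local Notation e1 := (@ebase R N 0).
Local Notation sector := (@truncated_sector R N a).
Local Notation mu := (@step_law R N s a hs).

Let s0 : 0 < s. Proof. by case/andP: hs => h _; lra. Qed.

Let api : 0 <= a <= pi.
Proof. by have := pi_gt0 R; case/andP: a0 => ? ? ?; apply/andP; split; lra. Qed.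

Lemma dotv_ebase (z : 'rV[R]_N) : dotv e1 z = z 0 (Ordinal N0).
Proof.
rewrite /dotv (bigD1 (Ordinal N0))//= !mxE/= mul1r big1 ?addr0// => i.
by rewrite -val_eqE/= mxE => /negbTE ->; rewrite mul0r.
Qed.

Lemma enorm_ebase : enorm e1 = 1.
Proof. by rewrite /enorm dotv_ebase mxE eqxx sqrtr1. Qed.

Lemma riesz_sector_fin : (rz sector < +oo)%E.
Proof.
have q1 := @pow2N_lt1 R (2 * s) (mulr_gt0 (ltr0n R 2) s0).
apply: le_lt_trans (ltry (4 ^+ N / (1 - 2 `^ (- (2 * s))))).
have cov : sector `<=` \bigcup_k @annulus R N (2 ^+ k).
  move=> z [_ /= z1]; have [k /andP[k1 k2]] := dyadic_le (ltW z1).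
  by exists k => //; rewrite /annulus/= k1/= -exprS ltW.
have mA k : measurable (@annulus R N (2 ^+ k)) by exact: measurable_annulus.
have mS := @measurable_truncated_sector R N a.
apply: (le_trans (measure_sigma_subadditive rz mA mS cov)).
apply: nneseries_geometric_le => // k.
have k0 : 0 < (2 : R) ^+ k by rewrite exprn_gt0.
apply: (le_trans (riesz_annulus_le N s0 k0)).
rewrite lee_fin ler_wpM2l ?exprn_ge0//.
by rewrite -powR_mulrn// -powRrM mulrC powRrM powR_mulrn// powR_ge0.
Qed.

Lemma cube_in_sector (rho t : R) : 0 < rho <= 2^-1 -> cos a < (1 - rho) / (1 + rho) ->
  4 <= t -> cube (t *: e1) (rho * t / N%:R) `<=`
    [set z | enorm (z - t *: e1) <= rho * t] `&` sector `&`
    [set z | 0 < enorm z <= 2 * t].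
Proof.
move=> r01 car t4 z zc; have t0 : 0 < t by lra.
have rt0 : 0 <= rho * t / N%:R.
  by case/andP: r01 => r0 _; rewrite divr_ge0// mulr_ge0// ltW.
have zn : enorm (z - t *: e1) <= rho * t.
  have := @enorm_le_cube R N (z - t *: e1) _ rt0.
  rewrite (mulrC N%:R) divfK ?pnatr_eq0 -?lt0n//; apply => i.
  by have := zc i; rewrite !mxE.
have [h1 h2 h3] := angle_near_axis api enorm_ebase t0 r01 car zn.
by split; [split=> //; split => //=; lra | apply/andP; split => //; lra].
Qed.

Lemma measurable_near (c : 'rV[R]_N) (r : R) : measurable [set z | enorm (z - c) <= r].
Proof.
have -> : [set z | enorm (z - c) <= r] = (fun z => enorm (z - c)) @^-1` `]-oo, r]%classic.
  by apply/seteqP; split => z /=; rewrite in_itv.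
rewrite -[X in measurable X]setTI.
by apply: (measurableT_comp measurable_enorm (measurable_shift c)).
Qed.

(** At relative distance rho / N from t e_1 there is a cube of side proportional to t, on
    which the density is at least of the order t ^ - (N + 2 s). *)
Lemma riesz_cube_sector_ge (rho : R) : 0 < rho <= 2^-1 ->
  cos a < (1 - rho) / (1 + rho) ->
  exists2 c : R, 0 < c & forall t : R, 4 <= t ->
    ((c * t `^ (- (2 * s)))%:E <=
      rz ([set z | enorm (z - t *: e1) <= rho * t]%R `&` sector))%E.
Proof.
move=> r01 car; have [r0 _] := andP r01.
have N0' : (0 : R) < N%:R by rewrite ltr0n.
exists ((2 `^ (N%:R + 2 * s))^-1 * (2 * rho / N%:R) ^+ N).
  by rewrite mulr_gt0 ?invr_gt0 ?powR_gt0// exprn_gt0// divr_gt0// mulr_gt0.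
move=> t t4; have t0 : 0 < t by lra.
have rt0 : 0 <= rho * t / N%:R by rewrite divr_ge0// mulr_ge0// ltW.
have sub := cube_in_sector r01 car t4.
have := @riesz_cube_ge R N s s0 (t *: e1) _ (2 * t) rt0 (fun z zc => (sub z zc).2).
rewrite (_ : _ * _ =
  (2 `^ (N%:R + 2 * s))^-1 * (2 * rho / N%:R) ^+ N * t `^ (- (2 * s))); last first.
  rewrite powRM ?(ltW t0)// -(powR_scale N s t0) (_ : 2 * (rho * t / N%:R) = (2 * rho / N%:R) * t).
    by rewrite [in RHS]mulrACA -invfM -exprMn.
  by ring.
move=> /le_trans; apply; apply: le_measure; rewrite ?inE.
- exact: measurable_cube.
- by apply: measurableI; [exact: measurable_near | exact: measurable_truncated_sector].
- by move=> z zc; exact: (sub z zc).1.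
Qed.

(** The mass by which the fractional measure is normalized is positive by the lower bound
    near the axis and finite by the covering of the sector with dyadic annuli. *)
Lemma step_law_riesz : exists2 k : R, 0 < k &
  forall A, mu A = (k%:E * rz (A `&` sector))%E.
Proof.
have mS : measurable sector := @measurable_truncated_sector R N a.
have C0 : 0 < fracC N s.
  case/andP: hs => hs1 hs2.
  rewrite /fracC divr_gt0// mulr_gt0 ?powR_gt0 ?pi_gt0 ?mulr_gt0 ?powR_gt0 ?Gamma_gt0//.
    by rewrite ltr_wpDl// divr_ge0.
  by rewrite subr_gt0.
have [rho r01 car] := aperture_ratio a0.
have [c c0 hc] := riesz_cube_sector_ge r01 car.
have rS0 : (0 < rz sector)%E.
  apply: (@lt_le_trans _ _ ((c * 4 `^ (- (2 * s)))%:E)).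
    by rewrite lte_fin mulr_gt0// powR_gt0.
  apply: le_trans (hc 4 (lexx _)) _; apply: le_measure; rewrite ?inE//.
  by apply: measurableI => //; exact: measurable_near.
have rSfin : rz sector \is a fin_num by rewrite ge0_fin_numE ?riesz_sector_fin// ltW.
exists (fracC N s / (fracC N s * fine (rz sector))).
  by rewrite divr_gt0// mulr_gt0// fine_gt0// rS0 riesz_sector_fin.
have E : mrestr (frac_measure N hs) (@measurable_truncated_sector R N a) setT =
   (fracC N s * fine (rz sector))%:E.
  by rewrite /mrestr/= setTI EFinM fineK.
have Z0 : 0 < fracC N s * fine (rz sector).
  by rewrite mulr_gt0// fine_gt0// rS0 riesz_sector_fin.
move=> A; rewrite /step_law /= /mnormalize; case: ifPn => [/orP[/eqP H|/eqP H]|_].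
- by have := etrans (esym E) H; move=> [/eqP]; rewrite gt_eqF.
- by have := etrans (esym E) H.
have -> : fine (mrestr (frac_measure N hs) (@measurable_truncated_sector R N a) setT) =
   fracC N s * fine (rz sector) by rewrite E.
by rewrite /= /mrestr /= EFinM muleAC.
Qed.

End step_law_bounds.

(** * Length of the steps *)

Section step_law_moments.
Context {R : realType} (N : nat) (s a : R).
Hypothesis N0 : (0 < N)%N.
Hypothesis hs : 2^-1 < s < 1.
Hypothesis a0 : 0 < a <= pi / 2.
Local Notation rz := (@riesz_measure R N s).
Local Notation e1 := (@ebase R N 0).
Local Notation sector := (@truncated_sector R N a).
Local Notation mu := (@step_law R N s a hs).

Let s0 : 0 < s. Proof. by case/andP: hs => h _; lra. Qed.

(** The probability to land near a given point of the axis has the order t ^ - (2 s), the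
    same as the cost in jump_cost_integral. This match of the orders is what lets a small
    exponent of the barrier absorb the cost at all scales at once. *)
Lemma step_law_near (rho : R) : 0 < rho <= 2^-1 ->
  cos a < (1 - rho) / (1 + rho) ->
  exists2 c : R, 0 < c & forall t : R, 4 <= t ->
    ((c * t `^ (- (2 * s)))%:E <= mu [set z | enorm (z - t *: e1) <= rho * t]%R)%E.
Proof.
move=> r01 car; have [c c0 hc] := riesz_cube_sector_ge N0 hs a0 r01 car.
have [k k0 muE] := step_law_riesz N0 hs a0.
exists (k * c); first exact: mulr_gt0.
move=> t t4; rewrite muE -mulrA EFinM; apply: lee_wpmul2l; last exact: hc.
by rewrite lee_fin ltW.
Qed.

(** The origin is added in order that the annuli cover a whole ball; the law does not
    charge it. *)
Let annulus0 (r : R) : set 'rV[R]_N := annulus r `|` [set z | enorm z = 0].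

Let measurable_annulus0 r : measurable (annulus0 r).
Proof.
apply: measurableU; first exact: measurable_annulus.
rewrite -[X in measurable X]setTI.
by apply: (measurable_enorm measurableT) (measurable_set1 (0 : R)).
Qed.

Let step_law_annulus : exists2 K : R, 0 < K & forall r : R, 0 < r ->
  (mu (annulus0 r) <= (K * r `^ (- (2 * s)))%:E)%E.
Proof.
have [k k0 muE] := step_law_riesz N0 hs a0.
exists (k * 4 ^+ N); first by rewrite mulr_gt0// exprn_gt0.
move=> r r0; rewrite muE -mulrA EFinM; apply: lee_wpmul2l.
  by rewrite lee_fin ltW.
apply: le_trans (riesz_annulus_le N s0 r0); apply: le_measure; rewrite ?inE.
- by apply: measurableI; [exact: measurable_annulus0 | exact: measurable_truncated_sector].
- exact: measurable_annulus.
by move=> z [[//|/= z0] [_ /=]]; rewrite z0 ltr10.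
Qed.

(** The second-order remainder of the norm after a jump of length q times the norm, in
    units of the norm: quadratic for short jumps, linear for long ones (see enormD_le). *)
Definition jump_cost (q : R) : R := Num.min (2 * q) (q ^+ 2 / 2).

Lemma jump_cost_ge0 q : 0 <= q -> 0 <= jump_cost q.
Proof. by move=> q0; rewrite le_min mulr_ge0//= divr_ge0// sqr_ge0. Qed.

Lemma measurable_jump_cost (t : R) (D : set 'rV[R]_N) :
  measurable_fun D (fun z => jump_cost (enorm z / t)).
Proof.
apply: measurable_funTS; rewrite /jump_cost.
have m1 : measurable_fun setT (fun z : 'rV[R]_N => enorm z / t).
  by apply: measurable_funM => //; exact: measurable_enorm.
apply: measurable_minr; first exact: measurable_funM.
by apply: measurable_funM => //; exact: measurable_funX.
Qed.

Let jump_cost_le z t : 0 < t -> 0 <= jump_cost (@enorm R N z / t).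
Proof. by move=> t0; rewrite jump_cost_ge0// divr_ge0 ?enorm_ge0 ?ltW. Qed.

(** A jump has length about r with probability at most of order r ^ - (2 s). The quadratic
    regime is summable over the jumps shorter than t because 2 s < 2, the linear regime over
    the longer ones because 2 s > 1, and both sums are dominated by the lengths close to
    t. *)
Lemma jump_cost_integral : exists2 C : R, 0 < C & forall t : R, 0 < t ->
  (\int[mu]_z (jump_cost (enorm z / t))%:E <= (C * t `^ (- (2 * s)))%:E)%E.
Proof.
have [K K0 hK] := step_law_annulus.
have [s12 s1] := andP hs.
pose p : R := 2 `^ (2 * s).
have p0 : 0 < p by rewrite powR_gt0.
have q1 : 0 <= p / 4 < 1.
  have := @pow2N_lt1 R (2 - 2 * s); rewrite opprB (powRB (x := 2)); last first.
    by rewrite pnatr_eq0 implybT.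
  by rewrite (_ : 2 `^ 2 = 4); [apply; lra | rewrite (powR_mulrn 2) // -natrX].
have q2 : 0 <= 2 / p < 1.
  have := @pow2N_lt1 R (2 * s - 1); rewrite opprB (powRB (x := 2)); last first.
    by rewrite pnatr_eq0 implybT.
  by rewrite powRr1//; apply; lra.
exists (K * p / (1 - p / 4) + 4 * K / (1 - 2 / p)).
  case/andP: q1 => _ q1; case/andP: q2 => _ q2.
  by rewrite addr_gt0// divr_gt0 ?mulr_gt0// subr_gt0.
move=> t t0; set T := t `^ (- (2 * s)).
have T0 : 0 < T by rewrite powR_gt0.
pose A := [set z : 'rV[R]_N | enorm z <= t].
have mA : measurable A.
  rewrite (_ : A = @enorm R N @^-1` `]-oo, t]%classic); last first.
    by apply/seteqP; split => z /=; rewrite in_itv.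
  rewrite -[X in measurable X]setTI.
  by apply: (measurable_enorm measurableT); exact: measurable_itv.
have mf (D : set 'rV[R]_N) : measurable_fun D (fun z => (jump_cost (enorm z / t))%:E).
  by apply/measurable_EFinP; exact: measurable_jump_cost.
rewrite -(setUv A) ge0_integral_setU;
  [ | exact: mA | exact: measurableC | exact: mf | | ]; last 2 first.
- by move=> z _; rewrite lee_fin jump_cost_le.
- by apply/disj_setPS => z [].
have -> : (K * p / (1 - p / 4) + 4 * K / (1 - 2 / p)) * T =
    (K * p * T) / (1 - p / 4) + (4 * K * T) / (1 - 2 / p) by ring.
rewrite EFinD; apply: leeD.
- (* the jumps shorter than t, by annuli of radius 2 ^- k t *)
  have := @integral_le_shells _ _ _ mu A _ (fun k => annulus0 ((2 ^+ k.+1)^-1 * t))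
    (fun k => (4^-1) ^+ k) (K * p * T) (p / 4) mA (mf _).
  apply.
  + by move=> z _; rewrite lee_fin jump_cost_le.
  + by move=> k; exact: measurable_annulus0.
  + move=> z zt; have [z0|z0] := eqVneq (enorm z) 0; first by exists 0%N => //; right.
    have zp : 0 < enorm z by rewrite lt_neqAle eq_sym z0 enorm_ge0.
    have [|k /andP[k1 k2]] := @dyadic_le R (t / enorm z); first by rewrite ler_pdivlMr// mul1r.
    exists k => //; left; rewrite /annulus/=; apply/andP; split.
      rewrite mulrC ler_pdivrMr ?exprn_gt0// mulrC -ler_pdivrMr//; exact: ltW.
    rewrite exprS invfM mulrA mulVKf ?pnatr_eq0// mulrC ler_pdivlMr ?exprn_gt0//.
    by rewrite mulrC -ler_pdivlMr.
  + by move=> k; rewrite exprn_ge0// invr_ge0.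
  + move=> k z _; rewrite lee_fin ge_min => zk; apply/orP; right.
    have zk' : enorm z / t <= 2^-1 ^+ k.
      case: zk => [/andP[_]|->]; last by rewrite mul0r exprn_ge0// invr_ge0.
      by rewrite mulrA ler_pdivrMr// exprS invfM mulrA mulfV ?pnatr_eq0// mul1r exprVn.
    have -> : (4^-1 : R) ^+ k = (2^-1 ^+ k) ^+ 2.
      by rewrite -exprM mulnC exprM; congr (_ ^+ k); rewrite expr2 -invfM -natrM.
    have z0 : 0 <= enorm z / t by rewrite divr_ge0 ?enorm_ge0// ltW.
    have := lerXn2r 2; nra.
  + exact: q1.
  + by rewrite !mulr_ge0// ltW.
  + move=> k; have k0 : 0 < (2 : R) ^+ k.+1 by rewrite exprn_gt0.
    apply: (@le_trans _ _ ((4^-1 ^+ k)%:E * (K * ((2 ^+ k.+1)^-1 * t) `^ (- (2 * s)))%:E)%E).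
      apply: lee_wpmul2l; first by rewrite lee_fin exprn_ge0// invr_ge0.
      by apply: hK; rewrite mulr_gt0// invr_gt0.
    rewrite -EFinM lee_fin powRM ?invr_ge0 ?(ltW k0) ?(ltW t0)// -/T.
    have -> : ((2 ^+ k.+1)^-1 : R) `^ (- (2 * s)) = p ^+ k.+1.
      rewrite -powR_inv1 ?(ltW k0)// -powRrM mulN1r opprK -(@powR_mulrn R 2 k.+1)//.
      by rewrite -powRrM mulrC powRrM powR_mulrn// ltW.
    by rewrite exprMn exprS le_eqVlt; apply/orP; left; apply/eqP; ring.
- (* the jumps longer than t, by annuli of radius 2 ^ k t *)
  have := @integral_le_shells _ _ _ mu (~` A) _ (fun k => annulus0 (2 ^+ k * t))
    (fun k => 4 * 2 ^+ k) (4 * K * T) (2 / p) (measurableC mA) (mf _).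
  apply.
  + by move=> z _; rewrite lee_fin jump_cost_le.
  + by move=> k; exact: measurable_annulus0.
  + move=> z /negP; rewrite -ltNge => tz.
    have [|k /andP[k1 k2]] := @dyadic_le R (enorm z / t); first by rewrite ler_pdivlMr// mul1r ltW.
    exists k => //; left; rewrite /annulus/= -ler_pdivlMr// k1/= mulrA -exprS.
    by rewrite -ler_pdivrMr// ltW.
  + by move=> k; rewrite mulr_ge0// exprn_ge0.
  + move=> k z _ zk; rewrite lee_fin ge_min; apply/orP; left.
    have : enorm z / t <= 2 * 2 ^+ k.
      case: zk => [/andP[_]|->]; last by rewrite mul0r mulr_ge0// exprn_ge0.
      by rewrite ler_pdivrMr// mulrA.
    by lra.
  + exact: q2.
  + by rewrite !mulr_ge0// ltW.
  + move=> k; have k0 : 0 < (2 : R) ^+ k by rewrite exprn_gt0.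
    apply: (@le_trans _ _ ((4 * 2 ^+ k)%:E * (K * (2 ^+ k * t) `^ (- (2 * s)))%:E)%E).
      by apply: lee_wpmul2l; [rewrite lee_fin mulr_ge0// ltW | apply: hK; rewrite mulr_gt0].
    rewrite -EFinM lee_fin powRM ?(ltW k0) ?(ltW t0)// -/T.
    have -> : ((2 ^+ k : R)) `^ (- (2 * s)) = (p^-1) ^+ k.
      rewrite -(@powR_mulrn R 2 k)// -powRrM mulrC powRrM powR_mulrn ?powR_ge0//.
      by rewrite powRN.
    by rewrite exprMn le_eqVlt; apply/orP; left; apply/eqP; ring.
Qed.

End step_law_moments.

(** * Mean of the steps *)

Section step_law_mean.
Context {R : realType} (N : nat) (s a : R).
Hypothesis N0 : (0 < N)%N.
Hypothesis hs : 2^-1 < s < 1.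
Hypothesis a0 : 0 < a <= pi / 2.
Local Notation rz := (@riesz_measure R N s).
Local Notation e1 := (@ebase R N 0).
Local Notation sector := (@truncated_sector R N a).
Local Notation mu := (@step_law R N s a hs).

Lemma integrable_jump_cost (t : R) : 0 < t ->
  mu.-integrable setT (fun z => (jump_cost (enorm z / t))%:E).
Proof.
move=> t0; apply/integrableP; split.
  by apply/measurable_EFinP; exact: measurable_jump_cost.
have [C C0 hC] := jump_cost_integral N0 hs a0.
apply: le_lt_trans (ltry (C * t `^ (- (2 * s)))); apply: le_trans (hC _ t0).
apply: ge0_le_integral => //.
- apply: measurableT_comp => //; apply/measurable_EFinP; exact: measurable_jump_cost.
- by apply/measurable_EFinP; exact: measurable_jump_cost.
by move=> z _ /=; rewrite lee_fin ger0_norm// jump_cost_ge0// divr_ge0 ?enorm_ge0// ltW.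
Qed.

Lemma integrable_enorm : mu.-integrable setT (EFin \o @enorm R N).
Proof.
apply: (@le_integrable _ _ _ mu setT _ _ (fun z => (4%:E + (jump_cost (enorm z / 1))%:E)%E)) => //.
- by apply/measurable_EFinP; exact: measurable_enorm.
- move=> z _ /=; have z0 := enorm_ge0 z.
  have c0 := jump_cost_ge0 z0.
  rewrite lee_fin divr1 !ger0_norm ?addr_ge0//; rewrite /jump_cost.
  by case: (leP (2 * enorm z) _) => h; nra.
- apply: integrableD => //; last exact: integrable_jump_cost.
  exact: finite_measure_integrable_cst.
Qed.

Lemma integrable_dotv (w : 'rV[R]_N) : mu.-integrable setT (fun z => (dotv w z)%:E).
Proof.
apply: (@le_integrable _ _ _ mu setT _ _ (fun z => (enorm w)%:E * (enorm z)%:E)%E) => //.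
- by apply/measurable_EFinP; apply: measurable_dotv.
- move=> z _ /=; rewrite lee_fin [leRHS]ger0_norm ?mulr_ge0 ?enorm_ge0//.
  exact: cauchy_schwarz.
- exact/integrableZl/integrable_enorm.
Qed.

Lemma integrable_coord i : mu.-integrable setT (fun z : 'rV[R]_N => (z 0 i)%:E).
Proof.
apply: le_integrable integrable_enorm => //.
  by apply/measurable_EFinP; exact: measurable_coord.
by move=> z _ /=; rewrite lee_fin [leRHS]ger0_norm ?enorm_ge0 ?coord_le_enorm.
Qed.

Let i0 : 'I_N := Ordinal N0.

Let flip (z : 'rV[R]_N) := flipv (fun i => i != i0) z.

Let sector_flip : flip @^-1` sector = sector.
Proof.
have h z : enorm (flip z) = enorm z.
  rewrite /enorm /dotv; congr Num.sqrt; apply: eq_bigr => i _; rewrite !mxE.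
  by rewrite mulrACA -expr2 sqrr_sign mul1r.
apply/seteqP; split => z; rewrite /truncated_sector/= /angle h;
by rewrite !(dotv_ebase N0) mxE eqxx expr0 mul1r.
Qed.

Lemma step_law_flip A : measurable A -> mu (flip @^-1` A) = mu A.
Proof.
move=> mA; have [k k0 muE] := step_law_riesz N0 hs a0.
rewrite !muE -{1}sector_flip -preimage_setI riesz_flip//.
by apply: measurableI => //; exact: measurable_truncated_sector.
Qed.

(** Changing the sign of all coordinates but the first preserves both the sector and the
    density. *)
Lemma step_law_coord0 i : i != i0 -> \int[mu]_z z 0 i = 0.
Proof.
move=> ii0; have intz := integrable_coord i.
have intN : mu.-integrable setT (fun z : 'rV[R]_N => (- z 0 i)%:E).
  exact: (integrableN intz).
have flipE (z : 'rV[R]_N) : (flip z) 0 i = - z 0 i by rewrite mxE ii0 expr1 mulN1r.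
have mflip : measurable_fun setT flip by exact: measurable_flipv.
have mi : measurable_fun setT (fun z : 'rV[R]_N => (z 0 i)%:E).
  by apply/measurable_EFinP; exact: measurable_coord.
have E : (\int[mu]_z (z 0 i)%:E = \int[mu]_z (- z 0 i)%:E)%E.
  transitivity (\int[pushforward mu flip]_z (z 0 i)%:E)%E.
    apply: eq_measure_integral => // B mB _; rewrite -[LHS](step_law_flip mB).
    by [].
  rewrite (integral_pushforward mflip mi) //.
    by apply: eq_integral => z _ /=; rewrite flipE.
  rewrite preimage_setT.
  by apply: eq_integrable intN => // z _ /=; rewrite flipE.
have : \int[mu]_z z 0 i = - \int[mu]_z z 0 i.
  rewrite {1}/Rintegral E -[LHS]/(\int[mu]_z (- z 0 i)).
  rewrite -mulN1r -RintegralZl//; apply: eq_Rintegral => z _; rewrite mulN1r//.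
by move=> ?; lra.
Qed.

(** The half-aperture of the sector is at most pi / 2, so the first coordinate of a step is
    nonnegative. *)
Lemma step_law_axis_ge0 : 0 <= \int[mu]_z dotv e1 z.
Proof.
have [k k0 muE] := step_law_riesz N0 hs a0.
have mS : measurable sector := @measurable_truncated_sector R N a.
rewrite /Rintegral fine_ge0// (@negligible_integral _ _ _ mu setT (~` sector))//.
- rewrite setDE setCK setTI; apply: integral_ge0 => z [/= za _]; rewrite lee_fin.
  rewrite leNgt; apply/negP => z0.
  have [/andP[c0 _] cE] := acos_def (angle_cos_bound e1 z).
  have : 0 < cos (angle e1 z).
    have pi0 := pi_gt0 R; case/andP: a0 => _ api.
    apply: cos_gt0_pihalf; apply/andP; split; last exact: lt_le_trans za _.
    by rewrite (lt_le_trans _ c0)// oppr_lt0 divr_gt0.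
  rewrite /angle cE ltNge => /negP; apply.
  by rewrite mulr_le0_ge0 ?(ltW z0)// invr_ge0 mulr_ge0 ?enorm_ge0.
- exact: measurableC.
- exact: integrable_dotv.
- by have := muE (~` sector); rewrite setICl measure0 mule0.
Qed.

(** The mean step is a nonnegative multiple of e_1, hence no other direction gains more on
    average: whatever player II does, the drift is at most the one of player I. *)
Lemma step_law_mean_le (w : 'rV[R]_N) : enorm w = 1 ->
  \int[mu]_z dotv w z <= \int[mu]_z dotv e1 z.
Proof.
move=> w1; have intz := integrable_coord.
have -> : \int[mu]_z dotv w z = w 0 i0 * \int[mu]_z dotv e1 z.
  have -> : \int[mu]_z dotv w z = \sum_i w 0 i * \int[mu]_z z 0 i.
    rewrite /Rintegral /dotv.
    under eq_integral do rewrite -sumEFin.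
    rewrite integral_sum//; last by move=> i; exact: (integrableZl measurableT (w 0 i) (intz i)).
    rewrite (_ : (\sum_i _)%E = (\sum_i w 0 i * \int[mu]_z z 0 i)%:E)//.
    rewrite -sumEFin; apply: eq_bigr => i _.
    under eq_integral do rewrite EFinM.
    rewrite integralZl// EFinM /Rintegral fineK//; exact: integrable_fin_num.
  rewrite (bigD1 i0)//= big1 ?addr0; last by move=> i ii0; rewrite step_law_coord0// mulr0.
  by congr (_ * _); apply: eq_Rintegral => z _; rewrite (dotv_ebase N0).
have w0 : w 0 i0 <= 1 by rewrite -w1 (le_trans (ler_norm _))// coord_le_enorm.
by have := step_law_axis_ge0; nra.
Qed.

End step_law_mean.

(** * The gauge of a cone *)

(** Concavity of the power function, from 1 + x <= expR x used at two points. *)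
Lemma powR_tangent (R : realType) (x y b : R) : 0 <= x -> 0 < y -> 0 < b <= 1 ->
  x `^ b <= y `^ b + b * (y `^ b / y) * (x - y).
Proof.
move=> x0 y0 /andP[b0 b1].
have key q : 0 < q -> q `^ b <= 1 + b * (q - 1).
  move=> q0; rewrite /powR gt_eqF//.
  pose p := expR (b * ln q).
  have p0 : 0 < p by exact: expR_gt0.
  have h1 : p * (1 + (1 - b) * ln q) <= q.
    have qE : q = p * expR ((1 - b) * ln q).
      by rewrite -expRD -mulrDl addrC subrK mul1r lnK// posrE.
    by rewrite [leRHS]qE ler_wpM2l ?(ltW p0)// expR_ge1Dx.
  have h2 : p * (1 - b * ln q) <= 1.
    rewrite -[leRHS]expR0 -(subrr (b * ln q)) expRD.
    by rewrite ler_wpM2l ?(ltW p0)// expR_ge1Dx.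
  rewrite -/p; nra.
have [->|xN0] := eqVneq x 0.
  rewrite powR0 ?gt_eqF// (_ : _ + _ = y `^ b * (1 - b)); last by field; rewrite gt_eqF.
  by rewrite mulr_ge0 ?powR_ge0 ?subr_ge0.
have x0' : 0 < x by rewrite lt_neqAle eq_sym xN0.
have := key (x / y) (divr_gt0 x0' y0).
have xE : x `^ b = (x / y) `^ b * y `^ b.
  by rewrite -powRM ?divfK ?gt_eqF ?divr_ge0 ?(ltW y0).
rewrite xE => h.
have -> : y `^ b + b * (y `^ b / y) * (x - y) = (1 + b * (x / y - 1)) * y `^ b.
  by field; rewrite gt_eqF.
by rewrite ler_wpM2r// powR_ge0.
Qed.

Section gauge.
Context {R : realType} {N : nat}.
Variable ax : 'rV[R]_N.
Hypothesis ax1 : enorm ax = 1.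
Implicit Types y h q : 'rV[R]_N.

(** A 1-homogeneous substitute for the distance to the vertex of a cone with axis ax. The
    tilt makes the opposite of its gradient, called descent below, point from every y to a
    point of the axis (pull_landing), while gauge y stays comparable to enorm y. *)
Definition gauge y : R := enorm y - dotv ax y / 2.

Definition descent y : 'rV[R]_N := 2^-1 *: ax - sphere_proj y.

Definition pull y : 'rV[R]_N := sphere_proj (descent y).

Lemma gauge_bounds y : enorm y / 2 <= gauge y <= 3 / 2 * enorm y.
Proof.
rewrite /gauge; have := cauchy_schwarz ax y; rewrite ax1 mul1r ler_norml => /andP[h1 h2].
by apply/andP; split; lra.
Qed.

Lemma enorm_sphere_proj y : y != 0 -> enorm (sphere_proj y) = 1.
Proof. exact: enorm_normalize. Qed.

Lemma sphere_proj0 : sphere_proj (0 : 'rV[R]_N) = 0.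
Proof. by rewrite /sphere_proj scaler0. Qed.

Lemma sphere_projK y : enorm y *: sphere_proj y = y.
Proof.
have [->|y0] := eqVneq y 0; first by rewrite sphere_proj0 scaler0.
by rewrite /sphere_proj scalerA mulfV ?scale1r// enorm_eq0.
Qed.

Lemma enorm_descent y : 2^-1 <= enorm (descent y) <= 3 / 2.
Proof.
have h1 : enorm (2^-1 *: ax) = 2^-1 by rewrite enormZ ax1 mulr1 ger0_norm// invr_ge0.
have [->|y0] := eqVneq y 0.
  rewrite /descent sphere_proj0 subr0 h1 lexx/=; lra.
have h2 := enorm_sphere_proj y0.
apply/andP; split.
  have := ler_enormD (descent y) (- (2^-1 *: ax)).
  rewrite /descent addrAC subrr add0r !enormN h1 h2; lra.
have := ler_enormD (2^-1 *: ax) (- sphere_proj y); rewrite enormN h1 h2 -/(descent y); lra.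
Qed.

Lemma descent_neq0 y : descent y != 0.
Proof.
by have /andP[+ _] := enorm_descent y; rewrite -enorm_eq0; apply: contraTneq => ->; lra.
Qed.

Lemma enorm_pull y : enorm (pull y) = 1.
Proof. exact/enorm_sphere_proj/descent_neq0. Qed.

Lemma descentE y : descent y = enorm (descent y) *: pull y.
Proof. by rewrite sphere_projK. Qed.

Lemma pull_landing y : y + enorm y *: descent y = (enorm y / 2) *: ax.
Proof. by rewrite scalerBr sphere_projK scalerA addrC subrK. Qed.

(** For short jumps this is 2 p q <= p ^ 2 + q ^ 2 with p and q the norms of y and y + h; for
    long ones it is the triangle inequality. *)
Lemma enormD_le y h : y != 0 ->
  enorm (y + h) <= enorm y + dotv (sphere_proj y) h + enorm y * jump_cost (enorm h / enorm y).
Proof.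
move=> y0; have yp : 0 < enorm y by rewrite lt_neqAle eq_sym enorm_eq0 y0 enorm_ge0.
rewrite /jump_cost /Num.min; case: ifPn => _.
  have := dotv_le (- sphere_proj y) h; rewrite dotvNl enormN (enorm_sphere_proj y0) mul1r => h1.
  have -> : enorm y * (2 * (enorm h / enorm y)) = 2 * enorm h by field; rewrite gt_eqF.
  have := ler_enormD y h; lra.
rewrite /sphere_proj dotvZl.
have E : enorm (y + h) ^+ 2 = enorm y ^+ 2 + 2 * dotv y h + enorm h ^+ 2.
  by rewrite !enorm_sqr !dotvE (dotvC h y); ring.
rewrite -(ler_pM2l yp).
have -> : enorm y * (enorm y + (enorm y)^-1 * dotv y h + enorm y * ((enorm h / enorm y) ^+ 2 / 2)) =
  (enorm y ^+ 2 + enorm (y + h) ^+ 2) / 2 by rewrite E; field; rewrite gt_eqF.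
by have := sqr_ge0 (enorm y - enorm (y + h)); lra.
Qed.

Lemma gaugeD_le y h : y != 0 ->
  gauge (y + h) <= gauge y - dotv (descent y) h + enorm y * jump_cost (enorm h / enorm y).
Proof.
move=> y0; have := enormD_le h y0; rewrite /gauge /descent !dotvE.
by lra.
Qed.

Lemma gauge_ge0 y : 0 <= gauge y.
Proof. by have /andP[+ _] := gauge_bounds y; apply: le_trans; rewrite divr_ge0 ?enorm_ge0. Qed.

Lemma gauge_gt0 y : y != 0 -> 0 < gauge y.
Proof.
move=> y0; have /andP[+ _] := gauge_bounds y; apply: lt_le_trans.
by rewrite divr_gt0// lt_neqAle eq_sym enorm_eq0 y0 enorm_ge0.
Qed.

(** The tangent inequality of the concave power, composed with the first-order expansion of
    the gauge: a global bound, valid for jumps of all sizes. *)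
Lemma gauge_powR_le (b : R) y h : 0 < b <= 1 -> y != 0 ->
  gauge (y + h) `^ b <= gauge y `^ b + b * (gauge y `^ b / gauge y) *
    (enorm y * jump_cost (enorm h / enorm y) - dotv (descent y) h).
Proof.
move=> b01 y0; have g0 := gauge_gt0 y0.
apply: le_trans (powR_tangent (gauge_ge0 (y + h)) g0 b01) _.
rewrite lerD2l ler_wpM2l//.
  by case/andP: b01 => ? _; rewrite mulr_ge0 ?divr_ge0 ?powR_ge0// ltW.
by have := gaugeD_le h y0; lra.
Qed.

Lemma gauge_powR_slope (b : R) y : 0 < b <= 1 -> y != 0 ->
  gauge y `^ b / gauge y * enorm y <= 3 * enorm y `^ b.
Proof.
move=> /andP[b0 b1] y0; have g0 := gauge_gt0 y0.
have yp : 0 < enorm y by rewrite lt_neqAle eq_sym enorm_eq0 y0 enorm_ge0.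
have /andP[g1 g2] := gauge_bounds y.
have h : gauge y `^ b <= 3 / 2 * enorm y `^ b.
  apply: (@le_trans _ _ ((3 / 2 * enorm y) `^ b)).
    by rewrite ge0_ler_powR ?nnegrE ?gauge_ge0 ?(ltW b0)// mulr_ge0// ltW.
  rewrite powRM ?(ltW yp)// ler_wpM2r ?powR_ge0//.
  by rewrite -[leRHS]powRr1// ler_powR//; lra.
rewrite mulrAC ler_pdivrMr//.
have e0 := powR_ge0 (enorm y) b.
have e1 := powR_ge0 (gauge y) b.
nra.
Qed.

Lemma gauge_powR_near (b rho : R) y q : 0 < b <= 1 -> rho <= 6^-1 ->
  enorm (q - (enorm y / 2) *: ax) <= 3 / 2 * rho * enorm y ->
  enorm y `^ b / 8 <= gauge q `^ b.
Proof.
move=> /andP[b0 b1] rho6 qy; have y0 := enorm_ge0 y.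
have q4 : enorm y / 4 <= enorm q.
  have := ler_enormD q (- (q - (enorm y / 2) *: ax)).
  rewrite opprB addrC subrK enormZ ax1 mulr1 -(opprB q) enormN.
  rewrite ger0_norm ?divr_ge0//; nra.
apply: (@le_trans _ _ ((enorm y / 8) `^ b)).
  rewrite powRM// ler_wpM2l ?powR_ge0//.
  by rewrite -[leLHS]powRr1// ger_powR//; lra.
rewrite ge0_ler_powR ?nnegrE ?gauge_ge0 ?(ltW b0) ?divr_ge0//.
by have /andP[h _] := gauge_bounds q; lra.
Qed.

End gauge.

(** * The barrier over one turn *)

Lemma measurable_mulmx_row (R : realType) (N : nat) (M : 'M[R]_N) :
  measurable_fun setT (fun z : 'rV[R]_N => z *m M).
Proof.
apply: measurable_fun_rVP => i; under eq_fun do rewrite mxE.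
by apply: measurable_sum => j; apply: measurable_funM => //; exact: measurable_coord.
Qed.

Lemma measurable_affine (R : realType) (N : nat) (y : 'rV[R]_N) (eps : R) (M : 'M[R]_N) :
  measurable_fun setT (fun z : 'rV[R]_N => y + eps *: (z *m M)).
Proof.
apply: measurable_fun_rVP => i; under eq_fun do rewrite !mxE.
apply: measurable_funD => //; apply: measurable_funM => //.
by apply: measurable_sum => j; apply: measurable_funM => //; exact: measurable_coord.
Qed.

Section one_step.
Context {R : realType} (N : nat) (s a : R).
Hypothesis N0 : (0 < N)%N.
Hypothesis hs : 2^-1 < s < 1.
Hypothesis a0 : 0 < a <= pi / 2.
Local Notation e1 := (@ebase R N 0).
Local Notation mu := (@step_law R N s a hs).

Lemma powR_halving (S t : R) : 0 < S -> 0 < t -> t <= 2 * S ->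
  S `^ (- (2 * s)) <= 4 * t `^ (- (2 * s)).
Proof.
move=> S0 t0 tS; have [s1 s2] := andP hs.
have s20 : 0 <= 2 * s by lra.
rewrite !powRN -ler_pdivrMl// -invfM lef_pV2 ?posrE ?mulr_gt0 ?powR_gt0//.
apply: (@le_trans _ _ ((2 * S) `^ (2 * s))).
  by apply: (ge0_ler_powR s20) => //; rewrite nnegrE ?mulr_ge0// ltW.
rewrite powRM ?(ltW S0)// ler_wpM2r ?powR_ge0//.
have -> : 4 = (2 : R) `^ 2 by rewrite (powR_mulrn 2)// -natrX.
by apply: ler_powR; [rewrite ler1n | lra].
Qed.

(** The value of the barrier Phi = gauge ^ b, set to 0 in a region near the axis, does not
    increase on average in one turn. The first-order terms of the two players cancel at
    worst, by step_law_mean_le. The remainder is of the order b (enorm y) ^ b S ^ - (2 s),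
    where S is the distance to the vertex in units of eps. When player I wins the coin, with
    probability of the order S ^ - (2 s) the jump lands where Phi vanishes, which gains the
    order (enorm y) ^ b. As b tends to 0 the gain prevails, for all y and eps. *)
Lemma one_step_supermartingale (rho : R) : 0 < rho <= 6^-1 ->
  cos a < (1 - rho) / (1 + rho) ->
  exists2 b : R, 0 < b <= 1 &
    forall (ax y : 'rV[R]_N) (eps : R) (M1 M2 : 'M[R]_N) (Phi : 'rV[R]_N -> R),
    enorm ax = 1 -> 0 < eps -> 8 * eps <= enorm y ->
    rotation M1 -> rotation M2 -> e1 *m M1 = pull ax y ->
    measurable_fun setT Phi ->
    (forall q, 0 <= Phi q <= gauge ax q `^ b) -> Phi y = gauge ax y `^ b ->
    (forall q, enorm (q - (enorm y / 2) *: ax) <= 3 / 2 * rho * enorm y -> Phi q = 0) ->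
    (\int[mu]_z (2^-1 * Phi (y + eps *: (z *m M1)) +
                 2^-1 * Phi (y + eps *: (z *m M2)))%:E <= (Phi y)%:E)%E.
Proof.
move=> r01 car; have [r0 r6] := andP r01.
have [c c0 hc] : exists2 c : R, 0 < c & forall t : R, 4 <= t ->
    ((c * t `^ (- (2 * s)))%:E <= mu [set z | enorm (z - t *: e1) <= rho * t]%R)%E.
  by apply: step_law_near => //; apply/andP; split=> //; lra.
have [C C0 hC] := jump_cost_integral N0 hs a0.
pose b : R := Num.min 1 (c / (24 * (8 * C))).
have b01 : 0 < b <= 1.
  by rewrite ge_min lexx lt_min ltr01 divr_gt0 // !mulr_gt0.
have bC : b * (24 * (8 * C)) <= c.
  by rewrite -ler_pdivlMr ?mulr_gt0 // ge_min lexx orbT.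
exists b => // ax y eps M1 M2 Phi ax1 eps0 yeps rM1 rM2 M1E mPhi PhiB Phiy Phi0.
have yp : 0 < enorm y by lra.
have y0 : y != 0 by rewrite -enorm_eq0 gt_eqF.
(* t is the length, in units of eps, of the jump of player I that ends on the axis. *)
pose S := enorm y / eps; pose l := enorm (descent ax y); pose t := enorm y * l / eps.
have S0 : 0 < S by rewrite divr_gt0.
have S8 : 8 <= S by rewrite ler_pdivlMr.
have [l1 l2] := andP (enorm_descent ax1 y); rewrite -/l in l1 l2.
have tS : t = S * l by rewrite /t /S mulrAC.
have t4 : 4 <= t by rewrite tS; nra.
have tS2 : t <= 2 * S by rewrite tS; nra.
have t0 : 0 < t by exact: lt_le_trans t4.
have hT : S `^ (- (2 * s)) <= 4 * t `^ (- (2 * s)) by exact: powR_halving.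
pose L := [set z : 'rV[R]_N | enorm (z - t *: e1) <= rho * t].
have mL : measurable L by exact: measurable_near.
(* the direction in which player II gains, seen in the frame of the step z *)
pose w := - pull ax y *m M2^T.
pose Y := enorm y `^ b.
have Y0 : 0 < Y by rewrite powR_gt0.
pose c1 := b * (gauge ax y `^ b / gauge ax y).
have c10 : 0 <= c1.
  by case/andP: b01 => ? _; rewrite mulr_ge0 ?divr_ge0 ?powR_ge0 ?gauge_ge0 ?ltW.
have c1y : c1 * enorm y <= 3 * b * Y.
  have := gauge_powR_slope ax1 b01 y0; rewrite -/Y /c1.
  case/andP: b01 => b0 _ h; rewrite -mulrA.
  by rewrite (_ : 3 * b * Y = b * (3 * Y)); [rewrite ler_pM2l | ring].
have rM2T : rotation M2^T.
  have [h1 h2] := rM2; split; last by rewrite det_tr.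
  by rewrite trmxK; apply: mulmx1C.
have w1 : enorm w = 1 by rewrite enorm_rotation// enormN enorm_pull.
have I1 (z : 'rV[R]_N) : dotv (descent ax y) (eps *: (z *m M1)) = eps * l * dotv e1 z.
  rewrite dotvZr descentE// dotvZl -/l -M1E dotv_rotation//; ring.
have I2 (z : 'rV[R]_N) : dotv (descent ax y) (eps *: (z *m M2)) = - (eps * l * dotv w z).
  rewrite dotvZr descentE// dotvZl -/l -[z in dotv w z]mulmx1.
  have -> : dotv w (z *m 1%:M) = - dotv (pull ax y) (z *m M2).
    have [h1 h2] := rM2; rewrite -h1 mulmxA dotv_rotation// -dotvNl //.
  by ring.
have J (z : 'rV[R]_N) M : rotation M ->
    enorm (eps *: (z *m M)) / enorm y = enorm z / S.
  by move=> rM; rewrite enormZ enorm_rotation// gtr0_norm// /S invf_div; field; rewrite !gt_eqF.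
pose jc (z : 'rV[R]_N) := jump_cost (enorm z / S).
have B1 z : Phi (y + eps *: (z *m M1)) <=
    gauge ax y `^ b + c1 * (enorm y * jc z - eps * l * dotv e1 z) - Y / 8 * \1_L z.
  have := gauge_powR_le ax1 (eps *: (z *m M1)) b01 y0; rewrite J// I1 -/(jc z) -/c1 => h.
  rewrite indicE; case: (boolP (z \in L)) => [/set_mem zL|_]; last first.
    rewrite mulr0 subr0; apply: le_trans h; by case/andP: (PhiB (y + eps *: (z *m M1))).
  have near : enorm (y + eps *: (z *m M1) - (enorm y / 2) *: ax) <= 3 / 2 * rho * enorm y.
    rewrite -(pull_landing ax y) descentE// -/l -M1E.
    have -> : y + eps *: (z *m M1) - (y + enorm y *: (l *: (e1 *m M1))) =
        eps *: ((z - t *: e1) *m M1).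
      rewrite mulmxBl -scalemxAl scalerBr !scalerA opprD addrACA subrr add0r; congr (_ - _ *: _).
      by rewrite /t; field; rewrite gt_eqF.
    rewrite enormZ gtr0_norm// enorm_rotation//.
    apply: (@le_trans _ _ (eps * (rho * t))); first by rewrite ler_pM2l.
    have -> : eps * (rho * t) = rho * l * enorm y by rewrite /t; field; rewrite gt_eqF.
    by rewrite ler_pM2r// (mulrC rho) ler_pM2r.
  rewrite Phi0// mulr1.
  by rewrite subr_ge0; apply: le_trans h; exact: (gauge_powR_near ax1 b01 r6 near).
have B2 z : Phi (y + eps *: (z *m M2)) <=
    gauge ax y `^ b + c1 * (enorm y * jc z + eps * l * dotv w z).
  have := gauge_powR_le ax1 (eps *: (z *m M2)) b01 y0; rewrite J// I2 -/(jc z) -/c1 opprK.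
  by apply: le_trans; case/andP: (PhiB (y + eps *: (z *m M2))).
pose G (z : 'rV[R]_N) := gauge ax y `^ b + (c1 * enorm y * jc z
   + (c1 * eps * l / 2 * dotv w z - (c1 * eps * l / 2 * dotv e1 z + Y / 16 * \1_L z))).
have GB z : 2^-1 * Phi (y + eps *: (z *m M1)) + 2^-1 * Phi (y + eps *: (z *m M2)) <= G z.
  have := B1 z; have := B2 z; rewrite /G; lra.
have mP M : measurable_fun setT (fun z : 'rV[R]_N => Phi (y + eps *: (z *m M))).
  by apply: (measurableT_comp mPhi); exact: measurable_affine.
have iw v : mu.-integrable setT (EFin \o dotv v) by exact: integrable_dotv.
have ij : mu.-integrable setT (EFin \o jc) by exact: integrable_jump_cost.
have iL : mu.-integrable setT (EFin \o (\1_L : _ -> R)) by apply: integrable_indic.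
have iZ (k : R) f : mu.-integrable setT (EFin \o f) ->
    mu.-integrable setT (EFin \o (fun z => k * f z)).
  by move=> intf; exact: (integrableZl measurableT k intf).
have iD f g : mu.-integrable setT (EFin \o f) -> mu.-integrable setT (EFin \o g) ->
    mu.-integrable setT (EFin \o (fun z => f z + g z)).
  by move=> intf intg; exact: (integrableD measurableT intf intg).
have iB f g : mu.-integrable setT (EFin \o f) -> mu.-integrable setT (EFin \o g) ->
    mu.-integrable setT (EFin \o (fun z => f z - g z)).
  by move=> intf intg; exact: (integrableB measurableT intf intg).
have ic (k : R) : mu.-integrable setT (EFin \o (fun=> k)) by exact: finite_measure_integrable_cst.
have iG : mu.-integrable setT (EFin \o G).
  apply: (iD) => //; apply: (iD); first exact: (iZ).
  by apply: (iB); [exact: (iZ) | apply: (iD); exact: (iZ)].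
apply: (@le_trans _ _ (\int[mu]_z (G z)%:E)%E).
  apply: ge0_le_integral => //.
  - move=> z _; rewrite lee_fin addr_ge0// mulr_ge0 ?invr_ge0//.
      by case/andP: (PhiB (y + eps *: (z *m M1))).
    by case/andP: (PhiB (y + eps *: (z *m M2))).
  - by apply/measurable_EFinP; apply: measurable_funD; exact: measurable_funM.
  - exact: (measurable_int mu iG).
  - by move=> z _; rewrite lee_fin.
rewrite -[leLHS]fineK ?integrable_fin_num// lee_fin -/(Rintegral mu setT G) Phiy.
have muLfin : mu L \is a fin_num by exact: fin_num_measure.
have -> : Rintegral mu setT G = gauge ax y `^ b + (c1 * enorm y * \int[mu]_z jc z
   + (c1 * eps * l / 2 * \int[mu]_z dotv w z -
      (c1 * eps * l / 2 * \int[mu]_z dotv e1 z + Y / 16 * fine (mu L)))).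
  rewrite /G RintegralD//; last first.
    apply: (iD); first exact: (iZ).
    by apply: (iB); [exact: (iZ) | apply: (iD); exact: (iZ)].
  rewrite Rintegral_cst// (_ : fine _ = 1) ?mulr1; last first.
    by rewrite -[RHS]/(fine (1%E : \bar R)); congr fine; exact: (@probability_setT _ _ _ mu).
  congr (_ + _).
  rewrite RintegralD//; [|exact: (iZ)|by apply: (iB); [exact: (iZ) | apply: (iD); exact: (iZ)]].
  rewrite RintegralZl//; congr (_ + _).
  rewrite RintegralB//; [|exact: (iZ)|by apply: (iD); exact: (iZ)].
  rewrite RintegralZl//; congr (_ - _).
  rewrite RintegralD//; [|exact: (iZ)|exact: (iZ)].
  rewrite !RintegralZl//; congr (_ + _ * _).
  by rewrite /Rintegral integral_indic// setIT.
have hmean := step_law_mean_le N0 hs a0 w1.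
have hjc : \int[mu]_z jc z <= C * S `^ (- (2 * s)).
  by rewrite -lee_fin fineK ?integrable_fin_num//; exact: hC.
have hL : c * t `^ (- (2 * s)) <= fine (mu L).
  by rewrite -lee_fin fineK//; exact: hc.
have T0 : 0 < t `^ (- (2 * s)) by rewrite powR_gt0.
have S0' : 0 < S `^ (- (2 * s)) by rewrite powR_gt0.
have E1 : c1 * eps * l / 2 * \int[mu]_z dotv w z <= c1 * eps * l / 2 * \int[mu]_z dotv e1 z.
  have l0 : 0 <= l := enorm_ge0 _.
  apply: ler_wpM2l hmean.
  exact: (divr_ge0 (mulr_ge0 (mulr_ge0 c10 (ltW eps0)) l0) (ler0n R 2)).
have jc0 : 0 <= \int[mu]_z jc z.
  by apply: Rintegral_ge0 => z _; rewrite jump_cost_ge0// divr_ge0 ?enorm_ge0// ltW.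
have E2 : c1 * enorm y * \int[mu]_z jc z <= Y / 16 * fine (mu L).
  apply: (@le_trans _ _ (3 * b * Y * (C * (4 * t `^ (- (2 * s)))))).
    apply: ler_pM => //; first exact: (mulr_ge0 c10 (ltW yp)).
    by apply: (le_trans hjc); rewrite ler_pM2l.
  apply: (@le_trans _ _ (Y / 16 * (c * t `^ (- (2 * s))))); last by rewrite ler_pM2l// divr_gt0.
  have -> : 3 * b * Y * (C * (4 * t `^ (- (2 * s)))) =
      Y / 16 * (b * (24 * (8 * C)) * t `^ (- (2 * s))) by field.
  by rewrite ler_pM2l ?divr_gt0// ler_pM2r.
have regroup (x p q v : R) : x + (p - (q + v)) = (x - v) + (p - q) by ring.
by rewrite gerDl regroup -[leRHS]addr0 lerD// subr_le0.
Qed.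

End one_step.

(** * Measurability of the game *)

Section measurable_game.
Context {R : realType} {N : nat}.
Hypothesis N0 : (0 < N)%N.
Variable rot : 'rV[R]_N -> 'rV[R]_N -> 'M[R]_N.
Hypothesis hrot : is_rotation_family rot.
Local Notation e1 := (@ebase R N 0).

(** The formula of rotation_familyE is rational in u, and on the set u = - e_1 the matrix is
    constant. *)
Lemma measurable_rotated d (T : measurableType d) (z u : T -> 'rV[R]_N) :
  measurable_fun setT z -> measurable_fun setT u -> (forall t, enorm (u t) = 1) ->
  measurable_fun setT (fun t => z t *m rot (u t) e1).
Proof.
move=> mz mu u1.
have mcoord (f : T -> 'rV[R]_N) i : measurable_fun setT f ->
    measurable_fun setT (fun t : T => f t 0 i : R).
  by move=> mf; exact: (measurableT_comp (@measurable_coord R N i) mf).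
have -> : (fun t => z t *m rot (u t) e1) = (fun t =>
    if enorm (u t + e1) == 0 then z t *m rot (- e1) e1
    else z t - (dotv (z t) (e1 + u t) / (1 + dotv e1 (u t))) *: (e1 + u t)
             + (2 * dotv (z t) e1) *: u t).
  apply/funext => t; case: ifPn; rewrite enorm_eq0 addr_eq0.
    by move=> /eqP ->.
  by move=> ue; rewrite (rotation_familyE _ hrot (enorm_ebase N0)).
have mD : measurable_fun setT (fun t => e1 + u t).
  apply: measurable_fun_rVP => i; under eq_fun do rewrite mxE.
  by apply: measurable_funD => //; exact: mcoord.
apply: measurable_fun_ifT.
- have -> : (fun t => enorm (u t + e1) == 0) = (fun t => enorm (e1 + u t) <= 0).
    by apply/funext => t; rewrite addrC le_eqVlt ltNge enorm_ge0 orbF.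
  apply: measurable_fun_ler => //; exact: (measurableT_comp measurable_enorm mD).
- exact: (measurableT_comp (measurable_mulmx_row _) mz).
- apply: measurable_fun_rVP => i; under eq_fun do rewrite !mxE.
  apply: measurable_funD.
    apply: measurable_funB; first exact: mcoord.
    apply: measurable_funM; last by apply: measurable_funD => //; exact: mcoord.
    apply: measurable_funM; first exact: measurable_dotv.
    apply: (measurableT_comp measurable_invr); apply: measurable_funD => //.
    exact: measurable_dotv.
  apply: measurable_funM; last exact: mcoord.
  by apply: measurable_funM => //; exact: measurable_dotv.
Qed.

Lemma measurable_rcons d1 d2 (T1 : measurableType d1) (T2 : measurableType d2)
    n (f : T1 -> n.-tuple T2) (g : T1 -> T2) :
  measurable_fun setT f -> measurable_fun setT g ->
  measurable_fun setT (fun t => [tuple of rcons (f t) (g t)] : n.+1.-tuple T2).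
Proof.
move=> mf mg; apply/measurable_fun_tnthP => i.
have [k ->|->] := unliftP ord_max i; last first.
  rewrite (_ : _ \o _ = g)//; apply/funext => t /=.
  by rewrite (tnth_nth (g t)) /= nth_rcons size_tuple ltnn eqxx.
rewrite (_ : _ \o _ = (fun t => tnth (f t) k)); last first.
  apply/funext => t; rewrite [LHS](tnth_nth (g t)) lift_max [RHS](tnth_nth (g t)).
  by rewrite /= nth_rcons size_tuple ltn_ord.
exact: (measurableT_comp (measurable_tnth k) mf).
Qed.

Lemma measurable_position n : measurable_fun setT (@position R N n).
Proof.
case: n => [|n].
  rewrite (_ : @position R N 0 = fst); first exact: measurable_fst.
  by apply/funext => -[x t]; rewrite /position (tuple0 t).
rewrite (_ : @position R N n.+1 = (fun h => (tnth h.2 ord_max).1)); last first.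
  apply/funext => -[x t]; rewrite /position /=.
  pose p0 : 'rV[R]_N * turn R N := (x, (0, true)).
  rewrite (tnth_nth p0) -[x]/(fst p0) last_map -nth_last size_tuple.
  by [].
apply: (measurableT_comp measurable_fst).
exact: (measurableT_comp (measurable_tnth ord_max) measurable_snd).
Qed.

Variables (eps : R) (sI sII : strategy R N).

Definition next_position n (h : history R N n) (t : turn R N) : 'rV[R]_N :=
  position h + eps *: (t.1 *m rot (if t.2 then sI n h else sII n h) e1).

Definition next_history n (h : history R N n) (t : turn R N) : history R N n.+1 :=
  (h.1, [tuple of rcons h.2 (next_position h t, t)]).

Lemma play_next x w n :
  play rot eps x sI sII w n.+1 = next_history (play rot eps x sI sII w n) (w n).
Proof. by rewrite /=; case: (w n) => z b. Qed.

Lemma process_next x w n : process rot eps x sI sII w n.+1 =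
  next_position (play rot eps x sI sII w n) (w n).
Proof. by rewrite /process play_next /position /= map_rcons last_rcons. Qed.

Lemma measurable_next_position n :
  measurable_fun setT (fun p : history R N n * turn R N => next_position p.1 p.2).
Proof.
have mp : measurable_fun setT (fun p : history R N n * turn R N => position p.1).
  exact: (measurableT_comp (@measurable_position n) measurable_fst).
have mz : measurable_fun setT (fun p : history R N n * turn R N => p.2.1).
  exact: (measurableT_comp measurable_fst measurable_snd).
have mu : measurable_fun setT (fun p : history R N n * turn R N =>
    if p.2.2 then sI n p.1 else sII n p.1).
  apply: measurable_fun_ifT.
  - exact: (measurableT_comp measurable_snd measurable_snd).
  - exact: (measurableT_comp (@measurable_direction R N sI n) measurable_fst).
  - exact: (measurableT_comp (@measurable_direction R N sII n) measurable_fst).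
have mr : measurable_fun setT (fun p : history R N n * turn R N =>
    p.2.1 *m rot (if p.2.2 then sI n p.1 else sII n p.1) e1).
  apply: measurable_rotated => // p.
  by case: ifP => _; exact: direction_unit.
apply: measurable_fun_rVP => i; rewrite /next_position; under eq_fun do rewrite !mxE.
apply: measurable_funD; first exact: (measurableT_comp (@measurable_coord R N i) mp).
apply: measurable_funM => //.
have := measurableT_comp (@measurable_coord R N i) mr.
by apply: eq_measurable_fun => p _; rewrite /= mxE.
Qed.

Lemma measurable_next_history n :
  measurable_fun setT (fun p : history R N n * turn R N => next_history p.1 p.2).
Proof.
apply/measurable_fun_pairP; split => /=.
  exact: (measurableT_comp measurable_fst measurable_fst).
apply: measurable_rcons.
  exact: (measurableT_comp measurable_snd measurable_fst).
apply/measurable_fun_pairP; split => /=; first exact: measurable_next_position.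
exact: measurable_snd.
Qed.

Lemma measurable_play d (T : measurableType d) (W : T -> nat -> turn R N) x n :
  (forall k, (k < n)%N -> measurable_fun setT (W ^~ k)) ->
  measurable_fun setT (fun t => play rot eps x sI sII (W t) n).
Proof.
elim: n => [|n IHn] mW; first exact: measurable_cst.
have mp : measurable_fun setT (fun t => (play rot eps x sI sII (W t) n, W t n)).
  apply/measurable_fun_pairP; split; last exact: mW.
  by apply: IHn => k kn; apply: mW; exact: ltnW.
under eq_fun do rewrite play_next.
exact: (measurableT_comp (@measurable_next_history n) mp).
Qed.

End measurable_game.

(** * Independence of the past and the next turn *)

Section independence.
Context d (T : measurableType d) (R : realType).
Variables (p : probability T R) (P : probability (seq_space T) R).
Hypothesis hP : is_product_law p P.

(** A pi-system that generates the events depending on the first n turns. *)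
Definition past_events n : set (set (nat -> T)) :=
  [set A | exists2 B : nat -> set T, (forall i, measurable (B i)) &
    A = [set w | forall i, (i < n)%N -> B i (w i)]].

Notation past n := (g_sigma_algebraType (past_events n)).

Lemma measurable_coordinate n : measurable_fun setT (fun w : seq_space T => w n).
Proof.
move=> _ B mB; rewrite setTI; apply: sub_sigma_algebra.
by exists n, B; split.
Qed.

Lemma past_event_measurable n : past_events n `<=` @measurable _ (seq_space T).
Proof.
move=> A [B mB ->].
have -> : [set w : nat -> T | forall i, (i < n)%N -> B i (w i)] =
    \bigcap_(i in `I_n) ((fun w : seq_space T => w i) @^-1` B i).
  by apply/seteqP; split => w h i; exact: h.
apply: fin_bigcap_measurable => // i _.
rewrite -[X in measurable X]setTI; exact: measurable_coordinate.
Qed.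

Lemma past_measurable n (A : set (past n)) : measurable A ->
  @measurable _ (seq_space T) A.
Proof.
apply: smallest_sub; last exact: past_event_measurable.
exact: sigma_algebra_measurable.
Qed.

Lemma measurable_past_coordinate n k : (k < n)%N ->
  measurable_fun setT (fun w : past n => w k).
Proof.
move=> kn _ B mB; rewrite setTI; apply: sub_sigma_algebra.
exists (fun i => if i == k then B else setT); first by move=> i; case: ifP.
apply/seteqP; split => w /=; first by move=> Bw i _; case: eqP => [->|].
by move=> /(_ _ kn); rewrite eqxx.
Qed.

(** Both sides are finite measures of A; on the pi-system they agree by the product law
    applied to n + 1 coordinates. *)
Lemma past_future_independent n (A : set (past n)) (C : set T) :
  measurable A -> measurable C ->
  P (A `&` [set w | C (w n)]) = (P A * p C)%E.
Proof.
move=> mA mC.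
have mCn : @measurable _ (seq_space T) [set w | C (w n)].
  rewrite -[X in measurable X]setTI; exact: measurable_coordinate.
have pC0 : 0 <= fine (p C) by rewrite fine_ge0.
have pCE : p C = (fine (p C))%:E by rewrite fineK// fin_num_measure.
pose m1 := mrestr P mCn.
pose m2 := mscale (NngNum pC0) P.
suff : m1 A = m2 A by rewrite pCE muleC; apply.
apply: (@g_sigma_algebra_measure_unique _ R (seq_space T) (past_events n)
  (@past_event_measurable n) (fun=> setT)) => //.
- by move=> _; exists (fun=> setT) => //; apply/seteqP; split.
- by apply/seteqP; split => // w _; exists 0%N.
- move=> _ _ [B mB ->] [B' mB' ->]; exists (fun i => B i `&` B' i).
    by move=> i; exact: measurableI.
  apply/seteqP; split => [w [h h'] i ij|w h]; first by split; [exact: h | exact: h'].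
  by split => i ij; have [] := h _ ij.
- move=> _ [B mB ->].
  rewrite -[LHS]/(P (_ `&` _)) -[RHS]/((fine (p C))%:E * P _)%E -pCE (hP n mB).
  have -> : [set w : nat -> T | forall i, (i < n)%N -> B i (w i)] `&` [set w | C (w n)] =
      [set w : nat -> T | forall i, (i < n.+1)%N -> (if i == n then C else B i) (w i)].
    apply/seteqP; split => [w [h Cw] i|w h].
      rewrite ltnS leq_eqVlt; case: eqP => [->//|_ /=]; exact: h.
    split; last by have := h n (ltnSn n); rewrite eqxx.
    by move=> i ij; have := h i (ltnW ij); rewrite (ltn_eqF ij).
  have mB' i : measurable (if i == n then C else B i) by case: ifP.
  rewrite (hP n.+1 mB').
  rewrite big_ord_recr/= eqxx muleC; congr (_ * _)%E.
  by apply: eq_bigr => i _; rewrite (ltn_eqF (ltn_ord i)).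
- move=> k; rewrite -[X in (X < _)%E]/(P (setT `&` [set w | C (w n)])) setTI.
  by rewrite -ge0_fin_numE// fin_num_measure.
Qed.

(** Fubini for the turn n given the past. This replaces conditional expectations: an
    inequality for every fixed past w, integrated over w, is all that is used. *)
Lemma integral_next n (f : past n * T -> \bar R) :
  measurable_fun setT f -> (forall x, 0 <= f x)%E ->
  (\int[P]_w f (w, w n) = \int[P]_w \int[p]_t f (w, t))%E.
Proof.
move=> mf f0.
have mid : measurable_fun setT (fun w : seq_space T => w : past n).
  by move=> _ A mA; rewrite setTI; exact: (@past_measurable n A mA).
pose midX : {mfun seq_space T >-> past n} := HB.pack
  (fun w : seq_space T => w : past n) (isMeasurableFun.Build _ _ _ _ _ mid).
have mpair : measurable_fun setT (fun w : seq_space T => (w : past n, w n)).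
  by apply/measurable_fun_pairP; split; [exact: mid | exact: (@measurable_coordinate n)].
pose Pn : probability (past n) R := distribution P midX.
pose m' : {measure set (past n * T) -> \bar R} :=
  pushforward P (fun w : seq_space T => (w : past n, w n)).
have E X : measurable X -> (Pn \x p)%E X = m' mpair X.
  apply: product_measure_unique => A B mA mB.
  exact: (past_future_independent mA mB).
transitivity (\int[m' mpair]_x f x)%E.
  by rewrite ge0_integral_pushforward// => x _; exact: f0.
transitivity (\int[(Pn \x p)%E]_x f x)%E.
  by apply: eq_measure_integral => X mX _; rewrite -E.
rewrite fubini_tonelli1//.
rewrite ge0_integral_distribution//.
  exact: measurable_fun_fubini_tonelli_F.
by move=> w; apply: integral_ge0 => t _; exact: f0.
Qed.

End independence.

(** * Escape probability of a supermartingale *)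

Section exit_bound.
Context {R : realType} {N : nat}.
Hypothesis N0 : (0 < N)%N.
Variable rot : 'rV[R]_N -> 'rV[R]_N -> 'M[R]_N.
Hypothesis hrot : is_rotation_family rot.
Variables (p : probability (turn R N) R) (P : probability (seq_space (turn R N)) R).
Hypothesis hP : is_product_law p P.
Variables (eps : R) (sI sII : strategy R N) (x0 : 'rV[R]_N).
Local Notation walk := (process rot eps x0 sI sII).
Local Notation past n := (g_sigma_algebraType (@past_events _ (turn R N) n)).

Lemma measurable_process d (T : measurableType d) (W : T -> nat -> turn R N) n :
  (forall k, (k < n)%N -> measurable_fun setT (W ^~ k)) ->
  measurable_fun setT (fun t => walk (W t) n).
Proof.
move=> mW; apply: (measurableT_comp (@measurable_position R N n)).
exact: measurable_play.
Qed.

Lemma measurable_process_past n k : (k <= n)%N ->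
  measurable_fun setT (fun w : past n => walk w k).
Proof.
move=> kn; apply: (@measurable_process _ (past n) (fun w => w)) => j jk.
by apply: measurable_past_coordinate; exact: leq_trans kn.
Qed.

Lemma measurable_process_seq k :
  measurable_fun setT (fun w : seq_space (turn R N) => walk w k).
Proof.
apply: (@measurable_process _ (seq_space (turn R N)) (fun w => w)) => j _.
exact: measurable_coordinate.
Qed.

Variables (U B : set 'rV[R]_N) (Phi : 'rV[R]_N -> R) (c0 : R).
Hypotheses (mU : measurable U) (mB : measurable B) (UB : U `<=` B).
Hypotheses (mPhi : measurable_fun setT Phi) (Phi0 : forall q, 0 <= Phi q).
Hypotheses (c00 : 0 < c0) (Phic : forall q, ~ B q -> c0 <= Phi q).
Hypothesis step : forall n (h : history R N n), U (position h) ->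
  (\int[p]_t (Phi (next_position rot eps sI sII h t))%:E <= (Phi (position h))%:E)%E.

Definition alive n : set (nat -> turn R N) := [set w | forall k, (k <= n)%N -> U (walk w k)].

Definition escape n : set (nat -> turn R N) :=
  [set w | (forall k, (k < n)%N -> U (walk w k)) /\ ~ B (walk w n)].

Lemma measurable_alive_past n : @measurable _ (past n) (alive n).
Proof.
have -> : alive n = \bigcap_(k in `I_n.+1) ((fun w : past n => walk w k) @^-1` U).
  by apply/seteqP; split => w h k; exact: h.
apply: fin_bigcap_measurable => // k kn.
by rewrite -[X in measurable X]setTI; apply: measurable_process_past.
Qed.

Lemma measurable_alive n : @measurable _ (seq_space (turn R N)) (alive n).
Proof. exact: (past_measurable (@measurable_alive_past n)). Qed.

Lemma measurable_escape n : @measurable _ (seq_space (turn R N)) (escape n).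
Proof.
have -> : escape n = \bigcap_(k in `I_n) ((fun w : seq_space (turn R N) => walk w k) @^-1` U) `&`
    (fun w : seq_space (turn R N) => walk w n) @^-1` (~` B).
  by apply/seteqP; split => w [h1 h2]; split => //; move=> k; exact: h1.
apply: measurableI.
  apply: fin_bigcap_measurable => // k kn.
  by rewrite -[X in measurable X]setTI; apply: measurable_process_seq.
rewrite -[X in measurable X]setTI; apply: measurable_process_seq => //.
exact: measurableC.
Qed.

Lemma integral_indicM d' (T : measurableType d') (m : {measure set T -> \bar R})
    (A : set T) (g : T -> R) :
  (\int[m]_(w in A) (g w)%:E = \int[m]_w (\1_A w * g w)%:E)%E.
Proof.
rewrite integral_mkcond; apply: eq_integral => w _.
by rewrite /patch indicE; case: (w \in A); rewrite ?mul1r ?mul0r.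
Qed.

Let mPX n k : measurable_fun setT (fun w : seq_space (turn R N) => (Phi (walk w k))%:E) /\
  measurable_fun (alive n : set (seq_space (turn R N)))
    (fun w : seq_space (turn R N) => (Phi (walk w k))%:E).
Proof.
have h : measurable_fun setT (fun w : seq_space (turn R N) => (Phi (walk w k))%:E).
  by apply/measurable_EFinP; exact: (measurableT_comp mPhi (measurable_process_seq k)).
by split=> //; exact: measurable_funTS.
Qed.

(** The hypothesis on one turn is applied for each fixed past on which the walk has stayed
    in U. *)
Lemma potential_decreases n :
  (\int[P]_(w in alive n) (Phi (walk w n.+1))%:E <=
   \int[P]_(w in alive n) (Phi (walk w n))%:E)%E.
Proof.
rewrite [leLHS]integral_indicM [leRHS]integral_indicM.
pose f (q : past n * turn R N) : \bar R :=
  (\1_(alive n) q.1 * Phi (next_position rot eps sI sII (play rot eps x0 sI sII q.1 n) q.2))%:E.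
have f0 q : (0 <= f q)%E by rewrite lee_fin mulr_ge0.
have mplay : measurable_fun setT (fun w : past n => play rot eps x0 sI sII w n).
  apply: (@measurable_play _ _ N0 _ hrot eps sI sII _ (past n) (fun w => w)) => k kn.
  exact: measurable_past_coordinate.
have mf : measurable_fun setT f.
  apply/measurable_EFinP; apply: measurable_funM.
    have := @measurable_indic _ (past n) R setT _ (@measurable_alive_past n).
    by move=> /measurableT_comp; apply; exact: measurable_fst.
  apply: (measurableT_comp mPhi).
  have mq : measurable_fun setT (fun q : past n * turn R N => (play rot eps x0 sI sII q.1 n, q.2)).
    apply/measurable_fun_pairP; split; last exact: measurable_snd.
    exact: (measurableT_comp mplay measurable_fst).
  exact: (measurableT_comp (@measurable_next_position _ _ N0 _ hrot eps sI sII n) mq).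
rewrite [leLHS](_ : _ = \int[P]_w f (w, w n))%E; last first.
  by apply: eq_integral => w _; rewrite /f process_next.
rewrite (integral_next hP mf f0).
have mF : measurable_fun setT (fun w : past n => \int[p]_t f (w, t))%E.
  exact: measurable_fun_fubini_tonelli_F.
apply: ge0_le_integral => //.
- by move=> w _; apply: integral_ge0 => t _; exact: f0.
- move=> _ Y mY; rewrite setTI; apply: (@past_measurable _ _ n).
  by rewrite -[X in measurable X]setTI; exact: mF.
- apply/measurable_EFinP; apply: measurable_funM.
    by apply: measurable_indic; exact: measurable_alive.
  by exact: (measurableT_comp mPhi (measurable_process_seq n)).
move=> w _; rewrite /f /= indicE; case: (boolP (w \in alive n)) => [/set_mem wA|_].
  under eq_integral do rewrite mul1r.
  by rewrite mul1r; apply: step; exact: (wA n (leqnn n)).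
by under eq_integral do rewrite mul0r; rewrite integral0 mul0r.
Qed.

(** A walk that was alive at time n and escapes or is alive at time n + 1 does only one of
    the two, as U is a subset of B; on an escape Phi is at least c0. *)
Lemma potential_split n :
  (\int[P]_(w in alive n.+1) (Phi (walk w n.+1))%:E + c0%:E * P (escape n.+1) <=
   \int[P]_(w in alive n) (Phi (walk w n.+1))%:E)%E.
Proof.
have sub : alive n.+1 `|` escape n.+1 `<=` alive n.
  move=> w [h k kn|[h _] k kn]; first by apply: h; exact: leqW.
  exact: h.
apply: (@le_trans _ _
  (\int[P]_(w in alive n.+1 `|` escape n.+1) (Phi (walk w n.+1))%:E)%E); last first.
  apply: ge0_subset_integral => //.
  - by apply: measurableU; [exact: measurable_alive | exact: measurable_escape].
  - exact: measurable_alive.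
  - exact: (mPX n n.+1).2.
  - by move=> w _; rewrite lee_fin.
rewrite ge0_integral_setU; [ | exact: measurable_alive | exact: measurable_escape | | | ].
- apply: leeD => //; rewrite -integral_cst; last exact: measurable_escape.
  apply: ge0_le_integral => //.
  + exact: measurable_escape.
  + by move=> w _; rewrite lee_fin ltW.
  + by apply: measurable_funTS; exact: (mPX n n.+1).1.
  + by move=> w [_ wB]; rewrite lee_fin Phic.
- by apply: measurable_funTS; exact: (mPX n n.+1).1.
- by move=> w _; rewrite lee_fin.
- by apply/disj_setPS => w [h [_ wB]]; apply: wB; apply: UB; exact: h.
Qed.

Lemma escape_sum n :
  (\sum_(k < n) c0%:E * P (escape k.+1) + \int[P]_(w in alive n) (Phi (walk w n))%:E
    <= (Phi x0)%:E)%E.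
Proof.
elim: n => [|n IHn].
  rewrite big_ord0 add0e.
  apply: (@le_trans _ _ (\int[P]_w (Phi x0)%:E)%E).
    apply: (@le_trans _ _ (\int[P]_w (Phi (walk w 0))%:E)%E) => //.
    apply: ge0_subset_integral => //.
    - exact: measurable_alive.
    - exact: (mPX 0 0).1.
    - by move=> w _; rewrite lee_fin.
  by rewrite integral_cst// [X in (_ * X)%E](@probability_setT _ _ _ P) mule1.
apply: le_trans IHn; rewrite big_ord_recr/= -addeA; apply: leeD => //.
rewrite addeC; apply: le_trans (potential_split n) _; exact: potential_decreases.
Qed.

(** The maximal inequality for the nonnegative supermartingale Phi stopped on leaving U. *)
Lemma escape_probability : (P (\bigcup_k escape k.+1) <= (Phi x0 / c0)%:E)%E.
Proof.
have mE k : @measurable _ (seq_space (turn R N)) (escape k.+1) by exact: measurable_escape.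
apply: (@le_trans _ _ (\sum_(k <oo) P (escape k.+1))%E).
  apply: (measure_sigma_subadditive P mE) => //.
  exact: bigcupT_measurable.
apply: lime_le; first by apply: is_cvg_nneseries => k _ _; exact: measure_ge0.
apply: nearW => n.
rewrite mulrC EFinM lee_pdivlMl// big_mkord ge0_sume_distrr//.
apply: le_trans (escape_sum n); rewrite leeDl//.
by apply: integral_ge0 => w _; rewrite lee_fin.
Qed.

Lemma measurable_exit_outside (D C : set 'rV[R]_N) : measurable D -> measurable C ->
  @measurable _ (seq_space (turn R N)) (exit_outside rot D eps x0 sI sII C).
Proof.
move=> mD mC.
have mpre k E : measurable E ->
    measurable ((fun w : seq_space (turn R N) => walk w k) @^-1` E).
  by move=> mE; rewrite -[X in measurable X]setTI; apply: measurable_process_seq.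
have -> : exit_outside rot D eps x0 sI sII C = \bigcup_(n in [set n | (1 <= n)%N])
    ((fun w : seq_space (turn R N) => walk w n) @^-1` (~` D) `&`
     (fun w : seq_space (turn R N) => walk w n) @^-1` (~` C) `&`
     \bigcap_(k in [set k | (1 <= k < n)%N]) ((fun w : seq_space (turn R N) => walk w k) @^-1` D)).
  apply/seteqP; split => [w [n [n1 nD h] nC]|w [n n1 [[nD nC] h]]].
    by exists n => //; split => // k; exact: h.
  by exists n => //; split => // k; exact: h.
apply: bigcup_measurable => n _; apply: measurableI; last first.
  apply: fin_bigcap_measurable.
    by apply: (@sub_finite_set _ _ `I_n) => // k /andP[].
  by move=> k _; exact: mpre.
by apply: measurableI; apply: mpre; exact: measurableC.
Qed.

(** At the first time k at which the walk is not in U, either it leaves D, so that k is the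
    exit time and the walk is out of C, or it is still in D and hence not in B. *)
Lemma exit_outside_escape (D C : set 'rV[R]_N) : U = D `&` B -> B `<=` C -> U x0 ->
  exit_outside rot D eps x0 sI sII C `<=` \bigcup_k escape k.+1.
Proof.
move=> UE BC Ux w [n [n1 nD h] nC].
have exU : exists k, ~~ `[< U (walk w k) >].
  by exists n; apply/asboolPn; rewrite UE => -[].
have [k /asboolPn kU kmin] := ex_minnP exU.
have k0 : (0 < k)%N by rewrite lt0n; apply/eqP => k0; apply: kU; rewrite k0.
have kn : (k <= n)%N by apply: kmin; apply/asboolPn; rewrite UE => -[].
exists k.-1 => //; rewrite prednK//; split.
  move=> j jk; apply: contrapT => jU.
  by have := kmin j (introN (asboolP _) jU); rewrite leqNgt jk.
move: kn; rewrite leq_eqVlt => /predU1P[->|kn]; first by move=> /BC.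
by move=> kB; apply: kU; rewrite UE; split => //; apply: h; rewrite k0.
Qed.

End exit_bound.

(** * The exterior cone *)

Section sector_geometry.
Context {R : realType} {N : nat}.
Implicit Types (ax x y q : 'rV[R]_N).

Lemma measurable_pull ax : measurable_fun setT (@pull R N ax).
Proof.
apply: (measurableT_comp measurable_sphere_proj); apply: measurable_fun_rVP => i.
have mc (f : 'rV[R]_N -> 'rV[R]_N) : measurable_fun setT f ->
    measurable_fun setT (fun y => f y 0 i).
  by move=> mf; exact: (measurableT_comp (@measurable_coord R N i) mf).
have -> : (fun y => descent ax y 0 i) = (fun y => 2^-1 * ax 0 i - sphere_proj y 0 i).
  by apply/funext => y; rewrite /descent [LHS]mxE mxE [X in _ + X]mxE.
by apply: measurable_funB => //; apply: mc; exact: measurable_sphere_proj.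
Qed.

Lemma measurable_gauge ax : measurable_fun setT (@gauge R N ax).
Proof.
apply: measurable_funB; first exact: measurable_enorm.
by apply: measurable_funM => //; exact: measurable_dotv.
Qed.

Lemma measurable_eball x (r : R) : measurable (eball x r).
Proof.
have -> : eball x r = (fun q => enorm (q - x)) @^-1` `]-oo, r[%classic.
  by apply/seteqP; split => z /=; rewrite in_itv.
rewrite -[X in measurable X]setTI.
by apply: (measurableT_comp measurable_enorm (measurable_shift x)).
Qed.

(** The rotation S carries the reference cone to the one at x, so the criterion of
    angle_near_axis is pulled back by its transpose. *)
Lemma cone_near_axis (D : set 'rV[R]_N) x (a : 'rV[R]_N) (t h rho tau : R)
    (S : 'M[R]_N) (q : 'rV[R]_N) :
  unit_sphere a -> 0 < t < pi / 2 -> rotation S ->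
  [set x + z *m S | z in finite_cone a t h] `<=` ~` D ->
  0 < rho <= 2^-1 -> cos t < (1 - rho) / (1 + rho) -> 0 < tau ->
  enorm (q - x - tau *: (a *m S)) <= rho * tau -> enorm (q - x) <= h -> ~ D q.
Proof.
move=> a1 /andP[t0 t2] rS cone r01 ct tau0 near qh.
have [SS dS] := rS; have TS : S^T *m S = 1%:M by exact: mulmx1C.
have rT : rotation S^T by split; rewrite ?trmxK ?det_tr.
pose z := (q - x) *m S^T.
have zS : z *m S = q - x by rewrite /z -mulmxA TS mulmx1.
have zE : z - tau *: a = (q - x - tau *: (a *m S)) *m S^T.
  by rewrite mulmxBl -scalemxAl -mulmxA SS mulmx1.
have tpi : 0 <= t <= pi by have pi0 := pi_gt0 R; apply/andP; split; lra.
have zn : enorm (z - tau *: a) <= rho * tau by rewrite zE enorm_rotation.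
have [za _ _] := angle_near_axis tpi a1 tau0 r01 ct zn.
apply: cone; exists z; last by rewrite zS addrC subrK.
right; split; first exact: ltW.
by rewrite (le_trans (dotv_le _ _))// a1 mul1r /z enorm_rotation.
Qed.

Lemma aperture_ratio_le (c rho rho' : R) : 0 < rho' -> rho' <= rho ->
  c < (1 - rho) / (1 + rho) -> c < (1 - rho') / (1 + rho').
Proof.
move=> r0 rr /lt_le_trans; apply.
by rewrite ler_pdivlMr; last lra; rewrite mulrAC ler_pdivrMr; [nra|lra].
Qed.

(** The choice of eta makes the barrier at the start at most xi times its least value d / 4
    to the power b at an escape. *)
Lemma powR_threshold (b xi d eta g : R) : 0 < b -> 0 < xi -> 0 < d -> 0 <= g ->
  g <= 3 / 2 * eta -> eta = xi `^ b^-1 * d / 6 -> g `^ b / (d / 4) `^ b <= xi.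
Proof.
move=> b0 xi0 d0 g0 ge etaE.
rewrite ler_pdivrMr ?powR_gt0 ?divr_gt0//.
have -> : xi * (d / 4) `^ b = (xi `^ b^-1 * (d / 4)) `^ b.
  rewrite [RHS]powRM ?powR_ge0 ?divr_ge0 ?(ltW d0)// -powRrM mulVf ?gt_eqF// powRr1//.
  exact: ltW.
apply: (ge0_ler_powR (ltW b0)); rewrite ?nnegrE ?mulr_ge0 ?powR_ge0 ?divr_ge0 ?(ltW d0)//.
by rewrite (le_trans ge)// etaE le_eqVlt; apply/orP; left; apply/eqP; field.
Qed.

End sector_geometry.

Section exterior_cone.
Context {R : realType} {N : nat}.
Variables (D : set 'rV[R]_N) (x a : 'rV[R]_N) (t h rho k : R) (S : 'M[R]_N).
Hypotheses (a1 : unit_sphere a) (t2 : 0 < t < pi / 2) (rS : rotation S).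
Hypothesis cone : [set x + z *m S | z in finite_cone a t h] `<=` ~` D.
Hypotheses (rho01 : 0 < rho <= 2^-1) (ctr : cos t < (1 - rho) / (1 + rho)) (k0 : 0 < k).
Local Notation v := (x + k *: (a *m S)).
Implicit Types q y : 'rV[R]_N.

Let ax1 : enorm (a *m S) = 1. Proof. by rewrite enorm_rotation. Qed.

Let kE : enorm (k *: (a *m S)) = k.
Proof. by rewrite enormZ ax1 mulr1 gtr0_norm. Qed.

Let subE q : q - x = (q - v) + k *: (a *m S).
Proof. by rewrite opprD addrA subrK. Qed.

Lemma enorm_from_base q : enorm (q - x) <= enorm (q - v) + k.
Proof. by rewrite subE (le_trans (ler_enormD _ _))// kE. Qed.

Lemma enorm_from_vertex q : enorm (q - v) <= enorm (q - x) + k.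
Proof.
have -> : q - v = (q - x) - k *: (a *m S) by rewrite [q - x]subE addrK.
by rewrite (le_trans (ler_enormD _ _))// enormN kE.
Qed.

(** The vertex v of the barrier is pushed into the cone, to distance k from x, which keeps
    the walk away from v; with k proportional to eps, the walk is then at least several
    minimal jumps away from v however close it comes to the boundary. *)
Lemma far_from_vertex (r : R) q : D q -> r <= rho * k -> r + k <= h -> r <= enorm (q - v).
Proof.
move=> Dq rk rh; rewrite leNgt; apply/negP => qv.
apply: (cone_near_axis a1 t2 rS cone rho01 ctr k0 _ _ Dq).
  by rewrite subE addrK (le_trans (ltW qv)).
by rewrite (le_trans (enorm_from_base q))// (le_trans _ rh)// lerD2r ltW.
Qed.

(** The target of player I is the point of the axis at distance r / 2 from v, and the ball
    of radius 3 / 2 rho' r around it is in the cone and still close to x. *)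
Lemma landing_in_cone (rho' r d : R) q :
  0 < r -> 0 < rho' <= 6^-1 -> rho' <= rho / 3 -> r < d + k -> k <= d / 8 -> d <= h ->
  enorm (q - v - (r / 2) *: (a *m S)) <= 3 / 2 * rho' * r ->
  ~ D q /\ eball x d q.
Proof.
move=> r0 /andP[rho0 rho6] rho3 rd kd dh near.
have near4 : enorm (q - v - (r / 2) *: (a *m S)) <= r / 4 by nra.
have nearr : enorm (q - v - (r / 2) *: (a *m S)) <= rho * (r / 2) by nra.
have qd : enorm (q - x) < d.
  have := ler_enormD (q - v - (r / 2) *: (a *m S)) ((r / 2) *: (a *m S)).
  rewrite subrK enormZ ax1 mulr1 gtr0_norm ?divr_gt0// => h1.
  have h2 := enorm_from_base q.
  move: (enorm (q - v - (r / 2) *: (a *m S))) (enorm (q - v)) (enorm (q - x)) near4 h1 h2 => *.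
  lra.
split=> //; have tau0 : 0 < r / 2 + k by rewrite addr_gt0// divr_gt0.
apply: (cone_near_axis a1 t2 rS cone rho01 ctr tau0 _ (ltW (lt_le_trans qd dh))).
have -> : q - x - (r / 2 + k) *: (a *m S) = q - v - (r / 2) *: (a *m S).
  have cancel_r (u1 u2 u3 : 'rV[R]_N) : u1 + u2 - (u3 + u2) = u1 - u3.
    by rewrite opprD addrACA subrr addr0.
  by rewrite [q - x]subE scalerDl cancel_r.
apply: (le_trans nearr); rewrite ler_wpM2l//; last by rewrite lerDl ltW.
by case/andP: rho01 => /ltW.
Qed.

End exterior_cone.

(** * Game regularity *)

Theorem theorem9p4 (R : realType) (N : nat) (p s alpha : R)
    (rot : 'rV[R]_N -> 'rV[R]_N -> 'M[R]_N)
    (P : probability (seq_space (turn R N)) R)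
    (D : set 'rV[R]_N)
    (hN : (2 <= N)%N) (hp : 2 <= p) (hs : 2^-1 < s < 1)
    (halpha : is_alpha N p alpha)
    (hrot : is_rotation_family rot)
    (hP : is_product_law (turn_law N alpha hs) P)
    (Dopen : open D) (Dconn : connected D) (Dbnd : bounded_set D)
    (Dcone : external_cone_condition D) :
  forall x : 'rV[R]_N, boundary D x -> game_regular rot P D x.
Proof.
move=> x bx xi delta xi0 delta0.
have N0 : (0 < N)%N by exact: leq_trans hN.
have [al0 _] := halpha.
have [a [t [h [a1 t2 h0 /(_ x bx)[S rS cone]]]]] := Dcone.
have [t0 tpi] := andP t2.
pose ax := a *m S.
have ax1 : enorm ax = 1 by rewrite enorm_rotation.
have [rhoc rc01 ctc] : exists2 rho : R, 0 < rho <= 2^-1 & cos t < (1 - rho) / (1 + rho).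
  by apply: aperture_ratio; rewrite t0 ltW.
have [rhoa ra01 cta] := aperture_ratio al0.
have [rc0 rc2] := andP rc01; have [ra0 ra2] := andP ra01.
pose rho := Num.min rhoa (Num.min 6^-1 (rhoc / 3)).
have rho0 : 0 < rho by rewrite !lt_min ra0 invr_gt0 ltr0n divr_gt0.
have rhoa' : rho <= rhoa by rewrite ge_min lexx.
have rho6 : rho <= 6^-1 by rewrite !ge_min lexx orbT.
have rhoc3 : rho <= rhoc / 3 by rewrite !ge_min lexx !orbT.
have r06 : 0 < rho <= 6^-1 by rewrite rho0 rho6.
have car := aperture_ratio_le rho0 rhoa' cta.
have [b b01 hstep] := one_step_supermartingale N0 hs al0 r06 car.
have [b0 b1] := andP b01.
(* far_from_vertex then keeps the walk at distance 8 * eps from the vertex *)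
pose K := 8 / rhoc.
have K0 : 0 < K by rewrite divr_gt0.
have K16 : 16 <= K by rewrite ler_pdivlMr//; lra.
pose d := Num.min delta h.
have d0 : 0 < d by rewrite lt_min delta0.
have ddelta : d <= delta by rewrite ge_min lexx.
have dh : d <= h by rewrite ge_min lexx orbT.
pose eta := xi `^ b^-1 * d / 6.
have eta0 : 0 < eta by rewrite divr_gt0// mulr_gt0// powR_gt0.
exists (Num.min (eta / 2) d), (Num.min (eta / 2) (d / 8) / K); split.
- by rewrite lt_min d0 (divr_gt0 eta0).
- by rewrite divr_gt0// lt_min (divr_gt0 eta0)// (divr_gt0 d0).
move=> eps /andP[eps0]; rewrite ltr_pdivlMr// lt_min mulrC => /andP[epseta epsd].
move=> x' x'near Dx'.
have /andP[x'eta x'd] : (enorm (x' - x) < eta / 2) && (enorm (x' - x) < d).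
  by rewrite -lt_min.
pose v := x + (K * eps) *: ax.
have Keps0 : 0 < K * eps by rewrite mulr_gt0.
have rcK : 8 * eps <= rhoc * (K * eps).
  by rewrite mulrA /K (mulrC rhoc) divfK// gt_eqF.
have K8h : 8 * eps + K * eps <= h.
  have : 8 * eps <= K * eps by rewrite ler_pM2r//; apply: le_trans K16; rewrite ler_nat.
  by move: epsd dh d0; clear; lra.
have far q : D q -> 8 * eps <= enorm (q - v).
  by move=> Dq; apply: (far_from_vertex a1 t2 rS cone rc01 ctc Keps0 Dq rcK K8h).
have land q y : D y -> eball x d y ->
    enorm (q - v - (enorm (y - v) / 2) *: ax) <= 3 / 2 * rho * enorm (y - v) ->
    ~ D q /\ eball x d q.
  move=> Dy yd; apply: (landing_in_cone a1 t2 rS cone rc01 ctc Keps0 _ r06 rhoc3 _ (ltW epsd) dh).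
    by apply: lt_le_trans (far _ Dy); rewrite mulr_gt0.
  by apply: le_lt_trans (enorm_from_vertex x a1 rS Keps0 y) _; rewrite ltrD2r.
have dist1 := enorm_from_base x a1 rS Keps0.
have dist2 := enorm_from_vertex x a1 rS Keps0.
pose B := eball x d; pose U := D `&` B.
(* leaving D within B is the desired outcome: there the barrier is set to 0 *)
pose G := ~` D `&` B.
have mD : measurable D by exact: open_measurable_rV.
have mB : measurable B by exact: measurable_eball.
have mU : measurable U by exact: measurableI.
have mG : measurable G by apply: measurableI => //; exact: measurableC.
pose Phi q : R := gauge ax (q - v) `^ b * \1_(~` G) q.
have mPhi : measurable_fun setT Phi.
  apply: measurable_funM; last by apply: measurable_indic; exact: measurableC.
  apply: (measurableT_comp (measurable_powR b)).
  exact: (measurableT_comp (measurable_gauge ax) (measurable_shift v)).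
have Phi0 q : 0 <= Phi q by rewrite mulr_ge0 ?powR_ge0.
have PhiE q : ~ G q -> Phi q = gauge ax (q - v) `^ b.
  by move=> Gq; rewrite /Phi indicE mem_set ?mulr1.
have PhiG q : G q -> Phi q = 0.
  by move=> Gq; rewrite /Phi indicE memNset ?mulr0// => /(_ Gq).
have Phile q : Phi q <= gauge ax (q - v) `^ b.
  by have [/PhiG ->|/PhiE ->//] := pselect (G q); exact: powR_ge0.
have Phic q : ~ B q -> (d / 4) `^ b <= Phi q.
  move=> Bq; rewrite PhiE; last by case.
  have qd : d <= enorm (q - x) by rewrite leNgt; apply/negP.
  apply: (ge0_ler_powR (ltW b0)); rewrite ?nnegrE ?gauge_ge0 ?divr_ge0 ?(ltW d0)//.
  have /andP[h1 _] := gauge_bounds ax1 (q - v).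
  by have := dist1 q; move: h1 qd epsd d0; rewrite -/ax -/v; clear; lra.
have mdir n : measurable_fun setT (fun hi : history R N n => pull ax (position hi - v)).
  apply: (measurableT_comp (measurable_pull ax)).
  exact: (measurableT_comp (measurable_shift v) (@measurable_position R N n)).
pose sI := @Strategy R N (fun n hi => pull ax (position hi - v)) mdir
  (fun n hi => enorm_pull ax1 (position hi - v)).
exists sI => sII.
have e1 := @enorm_ebase R N N0.
have step n (hi : history R N n) : U (position hi) ->
    (\int[turn_law N alpha hs]_u (Phi (next_position rot eps sI sII hi u))%:E <=
     (Phi (position hi))%:E)%E.
  move=> [Dy By]; set y := position hi in Dy By *.
  have mnext : measurable_fun setT (fun u : turn R N =>
      (Phi (next_position rot eps sI sII hi u))%:E).
    apply/measurable_EFinP; apply: (measurableT_comp mPhi).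
    exact: (measurableT_comp (@measurable_next_position _ _ N0 _ hrot eps sI sII n)
      (pair1_measurable hi)).
  rewrite /turn_law /= fubini_tonelli1//; last by move=> u; rewrite lee_fin.
  have rI := hrot _ _ (direction_unit sI hi) e1.
  have rII := hrot _ _ (direction_unit sII hi) e1.
  have [rM1 M1E _ _] := rI; have [rM2 _ _ _] := rII.
  have half : (1 - 2^-1 : R) = 2^-1 by rewrite [X in X - _](splitr 1) mul1r addrK.
  pose F q := Phi (q + v).
  have mF : measurable_fun setT F.
    apply: (measurableT_comp mPhi).
    by have := measurable_shift (- v); under eq_fun do rewrite opprK.
  have Fb q : 0 <= F q <= gauge ax q `^ b.
    by rewrite /F Phi0 (le_trans (Phile _))// addrK.
  have Fy : F (y - v) = gauge ax (y - v) `^ b by rewrite /F subrK PhiE// => -[].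
  have F0 q : enorm (q - (enorm (y - v) / 2) *: ax) <= 3 / 2 * rho * enorm (y - v) -> F q = 0.
    move=> near; apply: PhiG; by apply: (@land _ y) => //; rewrite addrK.
  have := hstep ax (y - v) eps _ _ F ax1 eps0 (far _ Dy) rM1 rM2 M1E mF Fb Fy F0.
  rewrite /F subrK; apply: le_trans; rewrite le_eqVlt; apply/orP; left; apply/eqP.
  apply: eq_integral => z _ /=.
  transitivity (\int[@bernoulli_prob R 2^-1]_c (Phi (next_position rot eps sI sII hi (z, c)))%:E)%E.
    by [].
  rewrite integral_bernoulli_prob; last by move=> c; rewrite lee_fin.
    rewrite /unstable.onem half -!EFinM -EFinD /next_position /= -/y.
    by congr (_ * Phi _ + _ * Phi _)%:E; rewrite addrAC subrK.
  by rewrite invr_ge0 ler0n invf_le1 ?ler1n.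
have Ux' : U x' by split.
have Bdelta : B `<=` eball x delta by move=> q; rewrite /B /eball/= => /lt_le_trans; exact.
have c00 : 0 < (d / 4) `^ b by rewrite powR_gt0// divr_gt0.
apply: (@le_trans _ _ (P (\bigcup_k escape rot eps sI sII x' U B k.+1))).
  apply: le_measure; rewrite ?inE.
  - exact: (@measurable_exit_outside _ _ N0 _ hrot eps sI sII x' D _ mD (measurable_eball x delta)).
  - apply: bigcupT_measurable => k.
    exact: (@measurable_escape _ _ N0 _ hrot eps sI sII x' U B mU mB k.+1).
  - exact: (@exit_outside_escape _ _ rot eps sI sII x' U B D _ erefl Bdelta Ux').
have UB : U `<=` B by move=> q [].
apply: (le_trans (@escape_probability _ _ N0 _ hrot _ _ hP eps sI sII x' U B Phi _
  mU mB UB mPhi Phi0 c00 Phic step)).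
rewrite lee_fin PhiE; last by case.
apply: (@powR_threshold R b xi d eta) => //; first exact: gauge_ge0.
have /andP[_ g2] := gauge_bounds ax1 (x' - v).
have := dist2 x'; move: g2 x'eta epseta; rewrite -/ax -/v; clear; lra.
Qed.
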